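(* Let $n>2$. Let $\Sigma:\mathcal{ES}_n^1\to\mathcal{F}_n^1$ be the (coarsely well-defined) map sending a vertex $[A*B]$ to the vertex $[A]$, and let $\imath:\mathcal{ES}_n^1\to\mathcal{FS}_n^1$ be the natural embedding sending a vertex $[A*B]$ to the vertex $[A*B]$. Then neither $\Sigma$ nor $\imath$ is a quasi-isometry. Moreover, there is no coarsely $\mathrm{Out}(F_n)$-equivariant quasi-isometry between $\mathcal{ES}_n^1$ and $\mathcal{F}_n^1$, and none between $\mathcal{ES}_n^1$ and $\mathcal{FS}_n^1$.
   Context: Let $F_n$ be the free group of rank $n$. All graphs carry the path metric with edges of length 1, with the natural isometric action of $\mathrm{Out}(F_n)$. Edge splitting graph $\mathcal{ES}_n^1$: vertices are conjugacy classes $[A*B]$ of free factorizations $F_n=A*B$ into two nontrivial free factors (unordered pair, both factors conjugated simultaneously by one element of $F_n$); two distinct vertices are adjacent if they have representatives with a common refinement which is a free factorization of $F_n$ into three nontrivial factors. Free factor graph $\mathcal{F}_n^1$: vertices are conjugacy classes $[A]$ of proper nontrivial free factors $A$ of $F_n$; two distinct vertices are adjacent if they have representatives one of which is contained in the other. (The map $\Sigma$ involves a choice of one of the two factors; different choices differ by a bounded amount.) Free splitting graph $\mathcal{FS}_n^1$: defined like $\mathcal{ES}_n^1$, but also allowing as vertices conjugacy classes of splittings of $F_n$ as an HNN-extension with trivial edge group; i.e. vertices are equivalence classes of one-edge graph of groups decompositions of $F_n$ with trivial edge group (free product or HNN type), and two distinct vertices are adjacent if they have a common refinement (a two-edge graph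 of groups decomposition of $F_n$ with trivial edge groups that collapses to each of them). A map $f:X\to Y$ between metric spaces with isometric $G$-actions is coarsely $G$-equivariant if there is a constant $C$ with $d(f(gx),gf(x))\le C$ for all $g\in G$, $x\in X$. *)

(* Defs.v *)
From HB Require Import structures.
From mathcomp Require Import all_boot all_order all_algebra.
From mathcomp Require Import all_classical all_reals all_analysis.

Set Implicit Arguments.
Unset Strict Implicit.
Unset Printing Implicit Defensive.

Local Open Scope classical_set_scope.
Local Open Scope group_scope.

(** * Graphs as metric spaces, and quasi-isometries *)

Section CoarseGeometry.
Variable R : realType.

Definition walk (V : Type) (adj : V -> V -> Prop) (x y : V) (k : nat) : Prop :=
  exists p : nat -> V,
    [/\ p 0%N = x, p k = y & forall i, (i < k)%N -> adj (p i) (p i.+1)].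

(* Path metric with edges of length 1, on the vertices; the value is +oo
   when no edge path joins the two vertices. *)
Definition gdist (V : Type) (adj : V -> V -> Prop) (x y : V) : \bar R :=
  ereal_inf [set (k%:R)%:E | k in walk adj x y].

Definition quasi_isometry (X Y : Type) (dX : X -> X -> \bar R)
    (dY : Y -> Y -> \bar R) (f : X -> Y) : Prop :=
  exists K C : R,
    [/\ (1 <= K)%R, (0 <= C)%R,
        forall x x',
          ((K^-1)%:E * dX x x' - C%:E <= dY (f x) (f x'))%E /\
          (dY (f x) (f x') <= K%:E * dX x x' + C%:E)%E
      & forall y, exists x, (dY y (f x) <= C%:E)%E].

Definition coarsely_equivariant (G X Y : Type) (actX : G -> X -> X)
    (actY : G -> Y -> Y) (dY : Y -> Y -> \bar R) (f : X -> Y) : Prop :=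
  exists C : R, forall g x, (dY (f (actX g x)) (actY g (f x)) <= C%:E)%E.

End CoarseGeometry.

(** * Groups, free groups, free products, automorphisms *)

Definition is_hom (G H : groupType) (phi : G -> H) : Prop :=
  forall x y, phi (x * y) = phi x * phi y.

Definition is_subgroup (G : groupType) (A : set G) : Prop :=
  A 1 /\ forall x y, A x -> A y -> A (x * y^-1).

Definition generated (G : groupType) (S : set G) : set G :=
  [set x | forall A, is_subgroup A -> S `<=` A -> A x].

Definition nontrivial (G : groupType) (A : set G) : Prop :=
  exists2 a, A a & a <> 1.

Definition conjs (G : groupType) (g : G) (A : set G) : set G :=
  [set a ^ g | a in A].

Definition hom_on (G H : groupType) (A : set G) (psi : G -> H) : Prop :=
  forall x y, A x -> A y -> psi (x * y) = psi x * psi y.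

Definition free_of_rank (n : nat) (F : groupType) : Prop :=
  exists b : 'I_n -> F, forall (H : groupType) (y : 'I_n -> H),
    exists! phi : F -> H, is_hom phi /\ forall i, phi (b i) = y i.

(* [F] is the internal free product of the subgroups [A i]. *)
Definition free_product (F : groupType) (I : finType) (A : I -> set F) : Prop :=
  (forall i, is_subgroup (A i)) /\
  forall (H : groupType) (psi : I -> F -> H),
    (forall i, hom_on (A i) (psi i)) ->
    exists! phi : F -> H,
      is_hom phi /\ forall i x, A i x -> phi x = psi i x.

Definition pairfam (T : Type) (A B : T) (i : bool) : T := if i then A else B.

Definition free_product2 (F : groupType) (A B : set F) : Prop :=
  free_product (pairfam A B).

Definition is_aut (F : groupType) (phi : F -> F) : Prop :=
  is_hom phi /\ bijective phi.

Definition out_class (F : groupType) (phi : F -> F) : set (F -> F) :=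
  [set psi | exists g, psi = (fun x => phi x ^ g)].

Definition Out (F : groupType) : Type :=
  {c : set (F -> F) | exists2 phi, is_aut phi & c = out_class phi}.

(** * Elementary facts *)

Section Facts.
Variable F : groupType.
Implicit Types (A B : set F) (g k x y : F) (phi : F -> F).

Lemma hom1 (G H : groupType) (phi : G -> H) : is_hom phi -> phi 1 = 1.
Proof. by move=> h; apply: (@mulgI _ (phi 1)); rewrite -h !mulg1. Qed.

Lemma homV (G H : groupType) (phi : G -> H) (z : G) :
  is_hom phi -> phi z^-1 = (phi z)^-1.
Proof.
by move=> h; apply: (@mulgI _ (phi z)); rewrite -h !mulgV (hom1 h).
Qed.

Lemma sg1 A : is_subgroup A -> A 1. Proof. by case. Qed.

Lemma sgV A x : is_subgroup A -> A x -> A x^-1.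
Proof. by case=> A1 AF Ax; rewrite -[_^-1]mul1g; apply: AF. Qed.

Lemma sgM A x y : is_subgroup A -> A x -> A y -> A (x * y).
Proof.
by move=> sA Ax Ay; rewrite -[y]invgK; apply: sA.2 => //; apply: sgV.
Qed.

Lemma conjsE g A x : conjs g A x <-> A (x ^ g^-1).
Proof.
split=> [[a Aa <-]|Ax]; first by rewrite conjgK.
by exists (x ^ g^-1) => //; rewrite conjgKV.
Qed.

Lemma conjsM g k A : conjs k (conjs g A) = conjs (g * k) A.
Proof.
by apply/seteqP; split=> x /conjsE; rewrite ?conjsE => H; apply/conjsE;
   move: H; rewrite ?conjsE invgM conjgM.
Qed.

Lemma conjs1 A : conjs 1 A = A.
Proof. by apply/seteqP; split=> x; rewrite conjsE invg1 conjg1. Qed.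

Lemma is_aut_conj g : is_aut (fun x => x ^ g).
Proof.
split; first by move=> x y; rewrite conjMg.
by exists (fun x => x ^ g^-1) => x; rewrite ?conjgK ?conjgKV.
Qed.

Lemma is_aut_inv phi : is_aut phi ->
  exists psi, [/\ is_aut psi, cancel phi psi & cancel psi phi].
Proof.
move=> [hphi [psi k1 k2]]; exists psi; split=> //; split; last by exists phi.
by move=> x y; rewrite -{1}[x]k2 -{1}[y]k2 -hphi k1.
Qed.

Lemma is_hom_comp (G H K : groupType) (p : G -> H) (q : H -> K) :
  is_hom p -> is_hom q -> is_hom (q \o p).
Proof. by move=> hp hq x y /=; rewrite hp hq. Qed.

Lemma aut_image_conjs phi g A : is_hom phi ->
  phi @` conjs g A = conjs (phi g) (phi @` A).
Proof.
move=> h; rewrite /conjs !image_comp; apply: eq_imagel => x _ /=.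
by rewrite !conjgE !h homV.
Qed.

Lemma conjs_image phi g A : conjs g (phi @` A) = (fun x => phi x ^ g) @` A.
Proof. by rewrite /conjs image_comp. Qed.

Lemma is_subgroup_image phi A : is_hom phi -> is_subgroup A ->
  is_subgroup (phi @` A).
Proof.
move=> h [A1 AF]; split; first by exists 1 => //; rewrite (hom1 h).
by move=> _ _ [x Ax <-] [y Ay <-]; exists (x * y^-1);
   [apply: AF | rewrite h homV].
Qed.

Lemma nontrivial_image phi A : is_aut phi -> nontrivial A ->
  nontrivial (phi @` A).
Proof.
move=> [h /bij_inj inj] [a Aa a1]; exists (phi a); first by exists a.
by rewrite -(hom1 h) => /inj.
Qed.

Lemma free_product_image phi (I : finType) (A : I -> set F) : is_aut phi ->
  free_product A -> free_product (fun i => phi @` A i).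
Proof.
move=> aphi [sA UA]; split=> [i|H psi hpsi].
  by apply: is_subgroup_image => //; case: aphi.
have [phi' [[hphi' _] k1 k2]] := is_aut_inv aphi.
have [//|f [[hf fE] fU]] := UA H (fun i => psi i \o phi).
  by move=> i x y Ax Ay /=; rewrite aphi.1 hpsi.
exists (f \o phi'); split.
  split; first exact: is_hom_comp.
  by move=> i _ [x Ax <-] /=; rewrite k1 (fE _ _ Ax).
move=> q [hq qE]; have -> : f = q \o phi.
  apply: fU; split; first by apply: is_hom_comp => //; case: aphi.
  by move=> i x Ax /=; rewrite (qE i).
by apply/funext => x /=; rewrite k2.
Qed.

Lemma free_product2_image phi A B : is_aut phi ->
  free_product2 A B -> free_product2 (phi @` A) (phi @` B).
Proof.
move=> aphi /(free_product_image aphi); rewrite /free_product2.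
by have -> : (fun i => phi @` pairfam A B i) = pairfam (phi @` A) (phi @` B);
   first by apply/funext; case.
Qed.

Lemma set2_inj (T : Type) (a b c d : T) : [set a; b] = [set c; d] ->
  (a = c /\ b = d) \/ (a = d /\ b = c).
Proof.
move=> E.
have: [set c; d] a by rewrite -E; left.
have: [set c; d] b by rewrite -E; right.
have: [set a; b] c by rewrite E; left.
have: [set a; b] d by rewrite E; right.
by move=> [] /= Ed [] /= Ec [] /= Eb [] /= Ea; subst; auto.
Qed.

End Facts.

(** * The edge splitting graph *)

Section EdgeSplitting.
Variable F : groupType.

(* The free factorization [A * B] is the unordered pair [{A, B}]; both factors are
   conjugated by the same element. *)
Definition es_class (A B : set F) : set (set (set F)) :=
  [set P | exists g, P = [set conjs g A; conjs g B]].

Definition is_es (c : set (set (set F))) : Prop :=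
  exists A B, [/\ free_product2 A B, nontrivial A, nontrivial B
                & c = es_class A B].

Definition ES : Type := {c : set (set (set F)) | is_es c}.

(* [A * B] is obtained from the free product of the [P i] by grouping the
   factors into two blocks. *)
Definition coarsens (I : finType) (P : I -> set F) (A B : set F) : Prop :=
  exists s : pred I, A = generated (\bigcup_(i in [set i | s i]) P i) /\
                     B = generated (\bigcup_(i in [set i | ~~ s i]) P i).

Definition es_adj (c c' : ES) : Prop :=
  c <> c' /\
  exists (A B A' B' : set F) (P : 'I_3 -> set F),
    [/\ sval c [set A; B], sval c' [set A'; B'],
        free_product P /\ (forall i, nontrivial (P i)),
        coarsens P A B & coarsens P A' B'].

Definition es_act_set (o : Out F) (c : set (set (set F))) : set (set (set F)) :=
  [set Q | exists phi P, [/\ sval o phi, c P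
                           & Q = [set phi @` A | A in P]]].

Lemma es_act_class (o : Out F) phi A B : is_aut phi -> sval o = out_class phi ->
  es_act_set o (es_class A B) = es_class (phi @` A) (phi @` B).
Proof.
move=> aphi oE; rewrite /es_act_set oE; apply/seteqP; split=> Q.
  move=> [_ [_ [[k ->] [g ->] ->]]]; exists (phi g * k).
  by rewrite image_setU !image_set1 -!conjs_image !aut_image_conjs ?conjsM //;
     case: aphi.
move=> [g ->]; exists (fun x => phi x ^ g), [set A; B]; split.
- by exists g.
- by exists 1; rewrite !conjs1.
- by rewrite image_setU !image_set1 !conjs_image.
Qed.

Lemma es_act_subproof (o : Out F) (c : ES) : is_es (es_act_set o (sval c)).
Proof.
have [phi aphi oE] := svalP o; have [A [B [fAB nA nB ->]]] := svalP c.
rewrite (es_act_class _ _ aphi oE); exists (phi @` A), (phi @` B).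
by split=> //; [exact: free_product2_image|exact: nontrivial_image..].
Qed.

Definition es_act (o : Out F) (c : ES) : ES :=
  exist _ (es_act_set o (sval c)) (es_act_subproof o c).

End EdgeSplitting.

(** * The free factor graph *)

Section FreeFactor.
Variable F : groupType.

Definition free_factor (A : set F) : Prop := exists B, free_product2 A B.

Definition ff_class (A : set F) : set (set F) := [set conjs g A | g in setT].

Definition is_ff (c : set (set F)) : Prop :=
  exists A, [/\ free_factor A, A <> setT, nontrivial A & c = ff_class A].

Definition FF : Type := {c : set (set F) | is_ff c}.

Definition ff_adj (c c' : FF) : Prop :=
  c <> c' /\
  exists A A', [/\ sval c A, sval c' A' & A `<=` A' \/ A' `<=` A].

Definition ff_act_set (o : Out F) (c : set (set F)) : set (set F) :=
  [set Q | exists phi A, [/\ sval o phi, c A & Q = phi @` A]].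

Lemma ff_act_class (o : Out F) phi A : is_aut phi -> sval o = out_class phi ->
  ff_act_set o (ff_class A) = ff_class (phi @` A).
Proof.
move=> aphi oE; rewrite /ff_act_set oE; apply/seteqP; split=> Q.
  move=> [_ [_ [[k ->] [g _ <-] ->]]]; exists (phi g * k) => //.
  by rewrite -conjs_image aut_image_conjs ?conjsM //; case: aphi.
move=> [g _ <-]; exists (fun x => phi x ^ g), A; split.
- by exists g.
- by exists 1; rewrite ?conjs1.
- by rewrite conjs_image.
Qed.

Lemma ff_act_subproof (o : Out F) (c : FF) : is_ff (ff_act_set o (sval c)).
Proof.
have [phi aphi oE] := svalP o; have [A [[B fAB] pA nA ->]] := svalP c.
rewrite (ff_act_class _ aphi oE); exists (phi @` A).
split=> //; last exact: nontrivial_image.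
- by exists (phi @` B); exact: free_product2_image.
- move=> E; apply: pA; apply/seteqP; split=> // x _.
  have [y Ay /(bij_inj aphi.2) <- //] : (phi @` A) (phi x) by rewrite E.
Qed.

Definition ff_act (o : Out F) (c : FF) : FF :=
  exist _ (ff_act_set o (sval c)) (ff_act_subproof o c).

End FreeFactor.

(** * The free splitting graph *)

(* Data of a graph of groups with trivial edge groups, realized inside [F]:
   an oriented finite graph with vertex set ['I_gnV] and edge set ['I_gnE], a
   maximal subtree [gtree], a subgroup [ggrp v] of [F] for every vertex and an
   element [gelt e] of [F] for every edge. *)
Record gog (F : groupType) : Type := Gog {
  gnV : nat;
  gnE : nat;
  gsrc : 'I_gnE -> 'I_gnV;
  gtgt : 'I_gnE -> 'I_gnV;
  gtree : pred 'I_gnE;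
  ggrp : 'I_gnV -> set F;
  gelt : 'I_gnE -> F }.

Notation gV X := 'I_(gnV X).
Notation gE X := 'I_(gnE X).

Section FreeSplitting.
Variable F : groupType.
Implicit Types X Y Z : gog F.

Definition gadj X (K : pred (gE X)) : rel (gV X) := fun v w =>
  [exists e, K e && (((gsrc e == v) && (gtgt e == w)) ||
                     ((gsrc e == w) && (gtgt e == v)))].

Definition spanning_tree X (K : pred (gE X)) : Prop :=
  (forall v w, connect (gadj K) v w) /\ (#|K|.+1 = gnV X)%N.

(* [F] is the fundamental group of [X] relative to the maximal subtree, i.e. the
   quotient of the free product of the [ggrp v] and of the free group on the
   edges by the relations [e = 1] for [e] in the subtree. *)
Definition decomposition X : Prop :=
  [/\ forall v : gV X, is_subgroup (ggrp v),
      spanning_tree (@gtree F X),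
      forall e : gE X, gtree e -> gelt e = 1
    & forall (H : groupType) (psi : gV X -> F -> H) (tau : gE X -> H),
        (forall v, hom_on (ggrp v) (psi v)) ->
        (forall e, gtree e -> tau e = 1) ->
        exists! phi : F -> H,
          [/\ is_hom phi, forall v x, ggrp v x -> phi x = psi v x
            & forall e, phi (gelt e) = tau e]].

Definition valence X (v : gV X) : nat :=
  #|[pred e : gE X | gsrc e == v]| + #|[pred e : gE X | gtgt e == v]|.

(* The condition on the vertices of valence one is minimality; for a single
   edge with two endpoints it says that both factors are nontrivial. A vertex
   of valence two with trivial group is harmless in [fs_adj]: the two collapses
   are then isomorphic. *)
Definition free_splitting (k : nat) X : Prop :=
  [/\ decomposition X, gnE X = k
    & forall v : gV X, valence v = 1%N -> nontrivial (ggrp v)].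

(* In the Bass-Serre tree of [X], vertex [v] has a lift [v~] with stabilizer
   [ggrp v] and [e] has a lift from [(gsrc e)~] to [gelt e * (gtgt e)~].
   [joins v w x e] says that some translate of that lift joins [v~] to
   [x * w~], in either direction. *)
Definition joins X (v w : gV X) (x : F) (e : gE X) : Prop :=
  [/\ gsrc e = v, gtgt e = w
    & exists a b, [/\ ggrp v a, ggrp w b & gelt e = a * x * b]] \/
  [/\ gsrc e = w, gtgt e = v
    & exists a b, [/\ ggrp v a, ggrp w b & (gelt e)^-1 = a * x * b]].

(* Isomorphism of graph of groups decompositions of [F] up to conjugation, i.e.
   equivariant isomorphism of the Bass-Serre trees: [v~] is sent to
   [h v * (f v)~]. *)
Definition gog_iso X Y : Prop :=
  exists (f : gV X -> gV Y) (j : gE X -> gE Y) (h : gV X -> F),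
    [/\ bijective f, bijective j,
        forall v, ggrp (f v) = conjs (h v) (ggrp v)
      & forall e, joins (f (gsrc e)) (f (gtgt e))
                    ((h (gsrc e))^-1 * gelt e * h (gtgt e)) (j e)].

(* [Y] is obtained from [X], up to isomorphism, by collapsing the edges outside
   the image of [j]. *)
Definition collapses X Y : Prop :=
  exists (f : gV X -> gV Y) (j : gE Y -> gE X) (h : gV X -> F),
    let collapsed := [pred e | e \notin codom j] in
    [/\ injective j,
        (forall w, exists v, f v = w) /\
        (forall v v', f v = f v' <-> connect (gadj collapsed) v v'),
        forall w, ggrp w = generated
          (\bigcup_(v in [set v | f v = w]) conjs (h v) (ggrp v) `|`
           [set (h (gsrc e))^-1 * gelt e * h (gtgt e) | e in
             [set e | collapsed e /\ f (gsrc e) = w]])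
      & forall e, joins (f (gsrc (j e))) (f (gtgt (j e)))
                    ((h (gsrc (j e)))^-1 * gelt (j e) * h (gtgt (j e))) e].

Definition fs_class X : set (gog F) :=
  [set Y | free_splitting 1 Y /\ gog_iso X Y].

Definition is_fs (c : set (gog F)) : Prop :=
  exists2 X, free_splitting 1 X & c = fs_class X.

Definition FS : Type := {c : set (gog F) | is_fs c}.

Definition fs_adj (c c' : FS) : Prop :=
  c <> c' /\
  exists X Y Z, [/\ sval c X, sval c' Y, free_splitting 2 Z, collapses Z X
                  & collapses Z Y].

Definition gog_image (phi : F -> F) X : gog F :=
  @Gog F (gnV X) (gnE X) (@gsrc F X) (@gtgt F X) (@gtree F X)
    (fun v => phi @` ggrp v) (fun e => phi (gelt e)).

Definition fs_act_set (o : Out F) (c : set (gog F)) : set (gog F) :=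
  [set Y | exists phi X, [/\ sval o phi, c X & fs_class (gog_image phi X) Y]].

Definition gog_groups X := forall v : gV X, is_subgroup (ggrp v).

Lemma free_splitting_groups k X : free_splitting k X -> gog_groups X.
Proof. by case=> -[]. Qed.

Lemma joins_flip X v w x (e : gE X) : gog_groups X ->
  joins v w x e -> joins w v x^-1 e.
Proof.
move=> sX [] [es et [a [b [Ga Gb E]]]]; [right|left]; split=> //;
  exists b^-1, a^-1; split; try exact: sgV.
- by rewrite E !invgM !mulgA.
- by rewrite -[gelt e]invgK E !invgM !mulgA.
Qed.

Lemma joins_coset X v w x a b (e : gE X) : gog_groups X ->
  ggrp v a -> ggrp w b -> joins v w (a * x * b) e -> joins v w x e.
Proof.
by move=> sX Ga Gb [] [es et [c [d [Gc Gd E]]]]; [left|right]; split=> //;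
   exists (c * a), (b * d); split; try exact: sgM; rewrite // E !mulgA.
Qed.

Lemma iso_joins X Y (f : gV X -> gV Y) (j : gE X -> gE Y) (h : gV X -> F) :
  gog_groups Y ->
  (forall v, ggrp (f v) = conjs (h v) (ggrp v)) ->
  (forall e, joins (f (gsrc e)) (f (gtgt e))
               ((h (gsrc e))^-1 * gelt e * h (gtgt e)) (j e)) ->
  forall v w x e, joins v w x e ->
    joins (f v) (f w) ((h v)^-1 * x * h w) (j e).
Proof.
move=> sY fG fE v w x e.
have mem u a : ggrp u a -> ggrp (f u) (a ^ h u) by move=> ?; rewrite fG; exists a.
move=> [] [<- <- [a [b [/mem Ga /mem Gb E]]]]; have := fE e.
  rewrite E => H; apply: (joins_coset sY Ga Gb); move: H; congr joins.
  by rewrite !conjgE !mulgA ?mulgK ?mulgVK.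
move=> /(joins_flip sY); rewrite !invgM invgK mulgA E => H.
apply: (joins_coset sY Ga Gb); move: H; congr joins.
by rewrite !conjgE !mulgA ?mulgK ?mulgVK.
Qed.

Lemma gog_iso_refl X : gog_groups X -> gog_iso X X.
Proof.
move=> sX; exists id, id, (fun=> 1); split; try by exists id.
  by move=> v; rewrite conjs1.
move=> e; left; split=> //; exists 1, 1; split; try exact: sg1.
by rewrite invg1 !mul1g !mulg1.
Qed.

Lemma gog_iso_trans X Y Z : gog_groups Z ->
  gog_iso X Y -> gog_iso Y Z -> gog_iso X Z.
Proof.
move=> sZ [f [j [h [bf bj fG fE]]]] [f' [j' [h' [bf' bj' fG' fE']]]].
exists (f' \o f), (j' \o j), (fun v => h v * h' (f v)).
split; try exact: bij_comp.
  by move=> v /=; rewrite fG' fG conjsM.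
move=> e /=; have := iso_joins sZ fG' fE' (fE e).
by congr joins; rewrite invgM !mulgA.
Qed.

Lemma gog_iso_sym X Y : gog_groups X -> gog_groups Y ->
  gog_iso X Y -> gog_iso Y X.
Proof.
move=> sX sY [f [j [h [[f' k1 k2] [j' l1 l2] fG fE]]]].
have fG' w : ggrp (f' w) = conjs (h (f' w))^-1 (ggrp w).
  by rewrite -{3}[w]k2 fG conjsM mulgV conjs1.
exists f', j', (fun w => (h (f' w))^-1); split=> //.
- by exists f.
- by exists j.
move=> e; have := fE (j' e); rewrite l2 invgK.
set e' := j' e; set s := gsrc e'; set t := gtgt e'.
have mem u b : ggrp (f u) b -> ggrp u (b ^ (h u)^-1).
  by rewrite fG => /conjsE.
move=> [] [-> -> [a [b [Ga Gb E]]]]; rewrite !k1.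
- left; split=> //; exists ((a ^ (h s)^-1)^-1), ((b ^ (h t)^-1)^-1).
  split; [by apply: sgV => //; exact: mem|by apply: sgV => //; exact: mem|].
  by rewrite E !conjgE !invgM !invgK !mulgA ?(mulgK, mulgVK) mulgV mul1g.
- right; split=> //; exists (b ^ (h t)^-1), (a ^ (h s)^-1).
  split; [exact: mem|exact: mem|].
  have -> : gelt e = b^-1 * (h t)^-1 * (gelt e')^-1 * h s * a^-1.
    by rewrite -[gelt e]invgK E !invgM invgK !mulgA.
  by rewrite !conjgE !invgK !mulgA ?(mulgK, mulgVK) mulgV mul1g.
Qed.

Lemma fs_class_eq X Y : gog_groups X -> gog_groups Y -> gog_iso X Y ->
  fs_class X = fs_class Y.
Proof.
move=> sX sY XY; apply/seteqP; split=> Z [sZ iZ]; split=> //;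
  have gZ := free_splitting_groups sZ.
- by apply: gog_iso_trans iZ => //; exact: gog_iso_sym.
- exact: gog_iso_trans XY iZ.
Qed.

Lemma gog_image_groups phi X : is_hom phi -> gog_groups X ->
  gog_groups (gog_image phi X).
Proof. by move=> h sX v; apply: is_subgroup_image. Qed.

Lemma gog_iso_image phi X Y : is_hom phi -> gog_iso X Y ->
  gog_iso (gog_image phi X) (gog_image phi Y).
Proof.
move=> hp [f [j [h [bf bj fG fE]]]]; exists f, j, (phi \o h); split=> //.
  by move=> v; rewrite /= fG aut_image_conjs.
move=> e; have -> : ((phi \o h) (gsrc e))^-1 *
    gelt (e : gE (gog_image phi X)) * (phi \o h) (gtgt e) =
    phi ((h (gsrc e))^-1 * gelt (e : gE X) * h (gtgt e)).
  by rewrite /= !hp homV.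
case: (fE e) => -[es et [a [b [Ga Gb E]]]]; [left|right]; split=> //;
  exists (phi a), (phi b); split; try by [exists a|exists b].
- by rewrite /= E !hp.
- by rewrite /= -homV // E !hp.
Qed.

Lemma gog_iso_conj phi g X : is_hom phi -> gog_groups X ->
  gog_iso (gog_image phi X) (gog_image (fun x => phi x ^ g) X).
Proof.
move=> hp sX; exists id, id, (fun=> g); split; try by exists id.
  by move=> v; rewrite /= conjs_image.
move=> e; left; split=> //; exists 1, 1; split.
- by exists 1; [exact: sg1|rewrite hom1 // conj1g].
- by exists 1; [exact: sg1|rewrite hom1 // conj1g].
- by rewrite mul1g mulg1 /= conjgE mulgA.
Qed.

Lemma free_splitting_image k phi X : is_aut phi ->
  free_splitting k X -> free_splitting k (gog_image phi X).
Proof.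
move=> aphi [[sX tX eX UX] kX nX]; split=> //; last first.
  by move=> v /nX; apply: nontrivial_image.
split=> //.
- by apply: gog_image_groups => //; case: aphi.
- by move=> e /eX /= ->; rewrite hom1 //; case: aphi.
move=> H psi tau hpsi htau.
have [phi' [[hphi' _] k1 k2]] := is_aut_inv aphi.
have [//|//|f [[hf fE fT] fU]] := UX H (fun v => psi v \o phi) tau.
  by move=> v x y Ax Ay; rewrite /= aphi.1; apply: hpsi; [exists x | exists y].
exists (f \o phi'); split.
  split; first exact: is_hom_comp.
  - by move=> v _ [x Ax <-] /=; rewrite k1 (fE _ _ Ax).
  - by move=> e /=; rewrite k1.
move=> q [hq qE qT]; have -> : f = q \o phi.
  apply: fU; split; first by apply: is_hom_comp => //; case: aphi.
  - by move=> v x Ax; apply: qE; exists x.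
  - by move=> e /=; rewrite -qT.
by apply/funext => x /=; rewrite k2.
Qed.

Lemma fs_act_class (o : Out F) phi X : is_aut phi -> sval o = out_class phi ->
  free_splitting 1 X ->
  fs_act_set o (fs_class X) = fs_class (gog_image phi X).
Proof.
move=> aphi oE sX; have [hp _] := aphi; have gX := free_splitting_groups sX.
rewrite /fs_act_set oE; apply/seteqP; split=> Y.
  move=> [_ [Z [[g ->] [sZ XZ] [sY ZY]]]]; split=> //.
  have gZ := free_splitting_groups sZ; have gY := free_splitting_groups sY.
  apply: gog_iso_trans (gog_iso_image hp XZ) _ => //.
  by apply: gog_iso_trans (gog_iso_conj g hp gZ) ZY.
move=> XY; exists phi, X; split=> //.
  by exists 1; apply/funext => x; rewrite conjg1.
by split=> //; exact: gog_iso_refl.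
Qed.

Lemma fs_act_subproof (o : Out F) (c : FS) : is_fs (fs_act_set o (sval c)).
Proof.
have [phi aphi oE] := svalP o; have [X sX ->] := svalP c.
rewrite (fs_act_class aphi oE sX); exists (gog_image phi X) => //.
exact: free_splitting_image.
Qed.

Definition fs_act (o : Out F) (c : FS) : FS :=
  exist _ (fs_act_set o (sval c)) (fs_act_subproof o c).

(* The one-edge decomposition of free product type given by [A * B]. *)
Definition amalgam (A B : set F) : gog F :=
  @Gog F 2 1 (fun=> ord0) (fun=> ord_max) predT
    (fun v => if v == ord0 then A else B) (fun=> 1).

Lemma ord2P (v : 'I_2) : v = ord0 \/ v = ord_max.
Proof. by case: v => -[|[|//]] i; [left|right]; apply: val_inj. Qed.

Lemma free_splitting_amalgam A B : free_product2 A B ->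
  nontrivial A -> nontrivial B -> free_splitting 1 (amalgam A B).
Proof.
move=> [sAB UAB] nA nB; split=> //; last by move=> v _ /=; case: ifP.
split=> //.
- by move=> v /=; case: ifP => _; [exact: (sAB true)|exact: (sAB false)].
- split; last by rewrite /= cardT size_enum_ord.
  have adj01 : gadj (@gtree F (amalgam A B)) ord0 ord_max.
    by apply/existsP; exists ord0.
  have adj10 : gadj (@gtree F (amalgam A B)) ord_max ord0.
    by apply/existsP; exists ord0.
  by move=> v w; case: (ord2P v) => ->; case: (ord2P w) => ->;
     rewrite ?connect0 ?connect1.
- move=> H psi tau hpsi htau.
  have [|f [[hf fE] fU]] := UAB H (pairfam (psi ord0) (psi ord_max)).
    by case; [exact: (hpsi ord0)|exact: (hpsi ord_max)].
  exists f; split; first split=> //.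
  + by move=> v; case: (ord2P v) => -> x /= Ax; [exact: (fE true)|exact: (fE false)].
  + by move=> e; rewrite /= hom1 // htau.
  move=> q [hq qE _]; apply: fU; split=> //.
  by case=> x Ax; [exact: (qE ord0)|exact: (qE ord_max)].
Qed.

Lemma gog_iso_amalgam_conj g A B : is_subgroup A -> is_subgroup B ->
  gog_iso (amalgam A B) (amalgam (conjs g A) (conjs g B)).
Proof.
move=> sA sB; exists id, id, (fun=> g); split; try by exists id.
  by move=> v /=; case: ifP.
move=> e; left; split=> //; exists 1, 1; split=> /=.
- by exists 1; [exact: sg1|rewrite conj1g].
- by exists 1; [exact: sg1|rewrite conj1g].
- by rewrite mul1g !mulg1 mulVg.
Qed.

Lemma gog_iso_amalgam_swap A B : is_subgroup A -> is_subgroup B ->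
  gog_iso (amalgam A B) (amalgam B A).
Proof.
move=> sA sB; exists (@rev_ord 2), id, (fun=> 1); split.
- by exists (@rev_ord 2); exact: rev_ordK.
- by exists id.
- by move=> v; case: (ord2P v) => -> /=; rewrite conjs1.
- move=> e; right; split=> /=; try exact: val_inj.
  by exists 1, 1; split; [exact: sg1|exact: sg1|rewrite !invg1 !mulg1].
Qed.

Definition imath_set (c : set (set (set F))) : set (gog F) :=
  [set Y | exists A B, c [set A; B] /\ fs_class (amalgam A B) Y].

Lemma imath_class A B : free_product2 A B -> nontrivial A -> nontrivial B ->
  imath_set (es_class A B) = fs_class (amalgam A B).
Proof.
move=> fAB nA nB; have sA : is_subgroup A := fAB.1 true.
have sB : is_subgroup B := fAB.1 false.
have sS g C : is_subgroup C -> is_subgroup (conjs g C).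
  by apply: is_subgroup_image; case: (is_aut_conj g).
have sM C D : is_subgroup C -> is_subgroup D -> gog_groups (amalgam C D).
  by move=> sC sD v /=; case: ifP.
apply/seteqP; split=> Y; last first.
  by exists A, B; split=> //; exists 1; rewrite !conjs1.
move=> [C [D [[g gE] YCD]]]; have CD := set2_inj gE.
have E : fs_class (amalgam A B) = fs_class (amalgam (conjs g A) (conjs g B)).
  by apply: fs_class_eq; [auto|auto|exact: gog_iso_amalgam_conj].
rewrite E; case: CD YCD => -[-> ->] //.
rewrite (@fs_class_eq (amalgam (conjs g A) (conjs g B))
                      (amalgam (conjs g B) (conjs g A))); [by []|auto|auto|].
by apply: gog_iso_amalgam_swap; auto.
Qed.

Lemma imath_subproof (c : ES F) : is_fs (imath_set (sval c)).
Proof.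
have [A [B [fAB nA nB ->]]] := svalP c.
by exists (amalgam A B); [exact: free_splitting_amalgam|exact: imath_class].
Qed.

(* [A * B] |-> [A * B]; by [imath_class] it does not depend on representatives. *)
Definition imath (c : ES F) : FS :=
  exist _ (imath_set (sval c)) (imath_subproof c).

End FreeSplitting.

(* [Sigma] sends every [A * B] to the class of one of its two factors. *)
Definition factor_choice (F : groupType) (Sigma : ES F -> FF F) : Prop :=
  forall c : ES F, exists A B : set F,
    sval c [set A; B] /\ sval (Sigma c) = ff_class A.

Lemma factor_choice_exists (F : groupType) :
  exists Sigma : ES F -> FF F, factor_choice Sigma.
Proof.
suff /choice[S SP] : forall c : ES F, exists d : FF F, exists A B : set F,
    sval c [set A; B] /\ sval d = ff_class A by exists S.
move=> c; have [A [B [fAB nA nB cE]]] := svalP c.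
have dP : is_ff (ff_class A).
  exists A; split=> //; first by exists B.
  move=> AT; have [//|f [[hf fE] _]] := fAB.2 F (pairfam (fun=> 1) id).
    by case=> x y _ _ //=; rewrite mulg1.
  have [b Bb] := nB; apply; have := fE false b Bb; rewrite /= => <-.
  by apply: (fE true); rewrite /= AT.
exists (exist _ _ dP), A, B; split=> //; rewrite cE.
by exists 1; rewrite !conjs1.
Qed.

Definition d_ES (R : realType) (F : groupType) : ES F -> ES F -> \bar R :=
  gdist R (@es_adj F).

Definition d_FF (R : realType) (F : groupType) : FF F -> FF F -> \bar R :=
  gdist R (@ff_adj F).

Definition d_FS (R : realType) (F : groupType) : FS F -> FS F -> \bar R :=
  gdist R (@fs_adj F).

(* Main.v *)
(* An automorphism that fixes a vertex of the target graph but moves every vertex of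
   the edge splitting graph arbitrarily far rules out coarsely equivariant
   quasi-isometries. Let [t] be the last element of a basis and [A] the free factor
   generated by the others; the automorphisms fixing [A] pointwise and sending [t] to
   [t h], with [h] in [A], fix the class of [A] and the HNN splitting with vertex group
   [A] and stable letter [t].

   To see that they move a free splitting [C * D] far away, let its arcs be the elements
   [g] of [A] such that some element conjugate into [C] or [D] has a cyclic normal form
   containing [t g t]. Adjacent splittings have a common arc, because one of the three
   factors of a common refinement contains an element of nonzero exponent sum in [t].
   The automorphism above multiplies arcs by [h] on the left. Finally, the Brooks
   counting quasi-morphism of a word [u] that fills [A] varies by a bounded amount on
   the arcs of one splitting: replacing [t] by [x t y], with [x] and [y] in [A], removes
   what two arcs have in common, and if [u] still occurred in one of them, the Whitehead
   graph of the elliptic elements would be connected without cut vertex, against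
   Whitehead's lemma. Hence elements [h] with many occurrences of [u] move every
   splitting far away. *)

From HB Require Import structures.
Require Import Defs.
From mathcomp Require Import all_boot all_order all_algebra.
From mathcomp Require Import all_classical all_reals all_analysis.
From mathcomp Require Import zify.

Set Implicit Arguments.
Unset Strict Implicit.
Unset Printing Implicit Defensive.

Local Open Scope classical_set_scope.
Local Open Scope group_scope.

(** * Reduced words in a free group *)

(** Permutations carry their inverse as data and form a [groupType], so that universal properties
    can be applied with an action as target. *)
Record sym (T : Type) := Sym {
  sfwd :> T -> T; sbwd : T -> T; sfK : cancel sfwd sbwd; sbK : cancel sbwd sfwd }.

Section Sym.
Variable T : Type.
Implicit Types f g : sym T.

Lemma sym_eqP f g : f =1 g -> f = g.
Proof.
case: f g => [f f' fK f'K] [g g' gK g'K] /= /funext E; subst g.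
have E : f' = g' by apply/funext => x; apply: (can_inj fK); rewrite f'K g'K.
subst g'; congr Sym; exact: Prop_irrelevance.
Qed.

HB.instance Definition _ := gen_eqMixin (sym T).
HB.instance Definition _ := gen_choiceMixin (sym T).

Definition sym_one : sym T := @Sym T id id (fun=> erefl) (fun=> erefl).
Definition sym_inv f : sym T := Sym (@sbK _ f) (@sfK _ f).
Definition sym_mul f g : sym T :=
  Sym (can_comp (@sfK _ f) (@sfK _ g)) (can_comp (@sbK _ g) (@sbK _ f)).

Fact sym_mulA : associative sym_mul. Proof. by move=> f g h; apply: sym_eqP. Qed.
Fact sym_1mul : left_id sym_one sym_mul. Proof. by move=> f; apply: sym_eqP. Qed.
Fact sym_mul1 : right_id sym_one sym_mul. Proof. by move=> f; apply: sym_eqP. Qed.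
Fact sym_Vmul : left_inverse sym_one sym_inv sym_mul.
Proof. by move=> f; apply: sym_eqP => x /=; rewrite sfK. Qed.
Fact sym_mulV : right_inverse sym_one sym_inv sym_mul.
Proof. by move=> f; apply: sym_eqP => x /=; rewrite sbK. Qed.

HB.instance Definition _ :=
  isGroup.Build (sym T) sym_mulA sym_1mul sym_mul1 sym_Vmul sym_mulV.

Lemma symM f g x : (f * g) x = f (g x). Proof. by []. Qed.

End Sym.

(** * Generating sets from uniqueness of homomorphisms *)

Section Generation.
Variable F : groupType.

Definition ltrans (g : F) : sym (F * bool).
Proof.
exists (fun p => (g * p.1, p.2)) (fun p => (g^-1 * p.1, p.2)).
- by move=> [h e] /=; rewrite mulKg.
- by move=> [h e] /=; rewrite mulVKg.
Defined.

Definition flip (K : set F) : sym (F * bool).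
Proof.
by exists (fun p => (p.1, p.2 (+) `[< K p.1 >])) (fun p => (p.1, p.2 (+) `[< K p.1 >]));
  move=> [h e] /=; rewrite -addbA addbb addbF.
Defined.

(* Conjugating left translation by the flip of the fibres over [K] changes nothing
   on [K], so by the uniqueness hypothesis it changes nothing at all. *)
Lemma subgroup_full (P K : set F) : is_subgroup K -> P `<=` K ->
  (forall phi psi : F -> sym (F * bool), is_hom phi -> is_hom psi ->
     (forall x, P x -> phi x = psi x) -> phi = psi) ->
  forall g, K g.
Proof.
move=> sK PK uniq g.
have hl : is_hom ltrans by move=> x y; apply: sym_eqP => -[h e] /=; rewrite mulgA.
have hf : is_hom (fun x => flip K * ltrans x * (flip K)^-1).
  by move=> x y; rewrite hl !mulgA mulgVK.
have E : ltrans = (fun x => flip K * ltrans x * (flip K)^-1).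
  apply: uniq => // x /PK Kx; apply: sym_eqP => -[h e] /=; congr pair.
  rewrite -addbA; have -> : `[< K (x * h) >] = `[< K h >].
    apply/asbool_equiv_eq; split=> [Kxh|]; last exact: sgM.
    by rewrite -(mulKg x h); apply: sgM => //; apply: sgV.
  by rewrite addbb addbF.
(* Evaluation at [(1, false)]: the plain translation stays on its sheet. The conjugated one changes
   sheet at [1], which lies in [K], and changes back exactly if [g] lies in [K]. *)
have /= := congr1 (fun f : F -> sym (F * bool) => (f g (1, false)).2) E.
by rewrite mulg1 (asboolT (sg1 sK)) => /esym/negbFE/asboolP.
Qed.

Lemma free_product_full (I : finType) (A : I -> set F) (K : set F) :
  free_product A -> is_subgroup K -> (forall i, A i `<=` K) -> forall g, K g.
Proof.
move=> [sA UA] sK AK; apply: (@subgroup_full (\bigcup_i A i)) => //.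
  by move=> x [i _ /AK].
move=> phi psi hphi hpsi E.
have [f [_ fU]] := UA (sym (F * bool)) (fun=> phi) (fun i x y _ _ => hphi x y).
have <- : f = phi by apply: fU.
by apply: fU; split=> // i x Ax; rewrite E //; exists i.
Qed.

End Generation.

Section Words.
Variable n : nat.

Definition letter := ('I_n * bool)%type.
Implicit Types (x y : letter) (w v p q r : seq letter).

Definition linv x : letter := (x.1, ~~ x.2).

Lemma linvK : involutive linv. Proof. by case=> i e; rewrite /linv /= negbK. Qed.
Lemma linv_inj : injective linv. Proof. exact: can_inj linvK. Qed.
Lemma linv_neq x : linv x != x.
Proof. by case: x => i e; apply/eqP => -[]; case: e. Qed.
Lemma linv_sym x y : (x == linv y) = (y == linv x).
Proof. by apply/eqP/eqP => ->; rewrite linvK. Qed.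

Definition nocancel x y := y != linv x.

Definition reduced w := sorted nocancel w.

Definition winv w := rev (map linv w).

Lemma winvK : involutive winv.
Proof. by move=> w; rewrite /winv map_rev revK mapK //; exact: linvK. Qed.
Lemma winv_cat p q : winv (p ++ q) = winv q ++ winv p.
Proof. by rewrite /winv map_cat rev_cat. Qed.
Lemma winv_cons x q : winv (x :: q) = rcons (winv q) (linv x).
Proof. by rewrite /winv /= rev_cons. Qed.
Lemma winv_rcons x q : winv (rcons q x) = linv x :: winv q.
Proof. by rewrite /winv map_rcons rev_rcons. Qed.
Lemma size_winv w : size (winv w) = size w.
Proof. by rewrite /winv size_rev size_map. Qed.

Lemma reduced_cons x w : reduced (x :: w) = (ohead w != Some (linv x)) && reduced w.
Proof. by case: w. Qed.

Lemma reduced_cat2 p x y q :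
  reduced (p ++ x :: y :: q) = [&& reduced (rcons p x), nocancel x y & reduced (y :: q)].
Proof.
case: p => [|z p] /=; first by [].
by rewrite cat_path /= rcons_path -andbA.
Qed.

Lemma reduced_catl p q : reduced (p ++ q) -> reduced p.
Proof. by case: p => //= x p; rewrite cat_path => /andP[]. Qed.

Lemma reduced_winv w : reduced (winv w) = reduced w.
Proof.
rewrite /reduced /winv rev_sorted; elim: w => [//|x [//|y w] IH].
rewrite /= -[RHS]/(nocancel x y && sorted nocancel (y :: w)) -IH /=; congr andb.
by rewrite /nocancel linvK eq_sym linv_sym eq_sym.
Qed.

(** Van der Waerden's method: the letters act by permutations on reduced words, and freeness extends
    this to an action of the whole group. *)
Definition lact x w := if w is y :: w' then if y == linv x then w' else x :: w else [:: x].

Lemma lact_reduced x w : reduced w -> reduced (lact x w).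
Proof.
case: w => [|y w] //= r; case: eqP => [_|/eqP ne]; first exact: path_sorted r.
by rewrite /= r andbT.
Qed.

Lemma lactK x w : reduced w -> lact (linv x) (lact x w) = w.
Proof.
case: w => [|y w] /=; first by rewrite linvK eqxx.
case: eqP => [->|_]; last by rewrite /= linvK eqxx.
by case: w => [|z w] //= /andP[/negbTE]; rewrite /nocancel => ->.
Qed.

Lemma lact_nc x w : reduced (x :: w) -> lact x w = x :: w.
Proof. by case: w => //= y w /andP[/negbTE ->]. Qed.

Definition rword := {w : seq letter | reduced w}.

Definition rlact x : sym rword.
Proof.
exists (fun w : rword => exist (fun w => reduced w) _ (lact_reduced x (valP w)))
       (fun w : rword => exist (fun w => reduced w) _ (lact_reduced (linv x) (valP w))).
- by move=> w; apply: val_inj => /=; rewrite lactK //; exact: valP.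
- by move=> w; apply: val_inj => /=; rewrite -{1}[x]linvK lactK //; exact: valP.
Defined.

End Words.

Definition is_basis (n : nat) (F : groupType) (b : 'I_n -> F) :=
  forall (H : groupType) (y : 'I_n -> H),
    exists! phi : F -> H, is_hom phi /\ forall i, phi (b i) = y i.

(** * Normal forms with respect to a basis *)

Section NormalForm.
Variables (F : groupType) (n : nat) (b : 'I_n -> F).
Implicit Types (x y : letter n) (w v p q r : seq (letter n)) (g h : F).

Definition lval x : F := if x.2 then b x.1 else (b x.1)^-1.
Definition weval w : F := foldr (fun x g => lval x * g) 1 w.

Lemma lvalV x : lval (linv x) = (lval x)^-1.
Proof. by case: x => i []; rewrite /lval /= ?invgK. Qed.

Lemma weval_cat p q : weval (p ++ q) = weval p * weval q.
Proof. by elim: p => [|x p IH] /=; rewrite ?mul1g // IH mulgA. Qed.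

Lemma weval_rcons p x : weval (rcons p x) = weval p * lval x.
Proof. by rewrite -cats1 weval_cat /= mulg1. Qed.

Lemma weval_winv w : weval (winv w) = (weval w)^-1.
Proof.
elim: w => [|x w IH]; first by rewrite invg1.
by rewrite winv_cons weval_rcons IH lvalV /= invgM.
Qed.

Hypothesis hb : is_basis b.

Lemma basis_ext (H : groupType) (y : 'I_n -> H) :
  exists phi : F -> H, is_hom phi /\ forall i, phi (b i) = y i.
Proof. by have [phi []] := hb y; exists phi. Qed.

Lemma basis_uniq (H : groupType) (phi psi : F -> H) : is_hom phi -> is_hom psi ->
  (forall i, phi (b i) = psi (b i)) -> phi = psi.
Proof.
move=> h1 h2 E; have [f [_ fU]] := hb (phi \o b).
have <- : f = phi by apply: fU.
by apply: fU; split=> // i; rewrite -E.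
Qed.

Lemma basis_full (K : set F) : is_subgroup K -> (forall i, K (b i)) -> forall g, K g.
Proof.
move=> sK bK; apply: (@subgroup_full _ (range b)) => //; first by move=> _ [i _ <-].
by move=> phi psi h1 h2 E; apply: basis_uniq => // i; apply: E; exists i.
Qed.

Definition nfhom := sval (cid (basis_ext (fun i => rlact (i, true)))).

Lemma nfhom_hom : is_hom nfhom.
Proof. by rewrite /nfhom; case: cid => ? []. Qed.

Lemma nfhom_lval x : nfhom (lval x) = rlact x.
Proof.
case: x => i e; rewrite /nfhom; case: cid => f [hf E] /=; rewrite /lval.
case: e => //=; rewrite homV // E; apply: sym_eqP => w; exact: val_inj.
Qed.

Definition nil_rword : rword n := exist _ [::] isT.

Definition nf g : seq (letter n) := sval (nfhom g nil_rword).

Lemma nf_reduced g : reduced (nf g). Proof. exact: valP. Qed.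

Lemma nf_lval x g : nf (lval x * g) = lact x (nf g).
Proof. by rewrite /nf nfhom_hom nfhom_lval. Qed.

Lemma nf1 : nf 1 = [::].
Proof. by rewrite /nf (hom1 nfhom_hom). Qed.

Lemma wevalK w : reduced w -> nf (weval w) = w.
Proof.
elim: w => [|x w IH] r /=; first exact: nf1.
by rewrite nf_lval IH ?lact_nc //; exact: path_sorted r.
Qed.

Lemma weval_lact x w : weval (lact x w) = lval x * weval w.
Proof.
case: w => [|y w] //=; case: eqP => [->|//].
by rewrite lvalV mulVKg.
Qed.

(** The elements [g] for which evaluation intertwines the action of [g] with left multiplication by
    [g] form a subgroup containing the basis; the empty word then gives the claim. *)
Lemma nfK : cancel nf weval.
Proof.
suff H g : forall w : rword n, weval (sval (nfhom g w)) = g * weval (sval w).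
  by move=> g; rewrite /nf H mulg1.
pose K : set F := [set g | forall w : rword n, weval (sval (nfhom g w)) = g * weval (sval w)].
apply: (@basis_full K) => [|i w].
  split=> [w|x y Kx Ky w]; first by rewrite (hom1 nfhom_hom) mul1g.
  rewrite nfhom_hom symM Kx -mulgA; congr (_ * _).
  apply: (@mulgI _ y); rewrite mulVKg -Ky -symM -nfhom_hom mulgV.
  by rewrite (hom1 nfhom_hom).
have -> : b i = lval (i, true) by [].
by rewrite nfhom_lval /= weval_lact.
Qed.

Lemma nf_inj : injective nf. Proof. exact: can_inj nfK. Qed.

Lemma nf_ind (P : F -> Prop) : P 1 -> (forall x g, P g -> P (lval x * g)) -> forall g, P g.
Proof. by move=> P1 PM g; rewrite -[g]nfK; elim: (nf g) => //= x w; apply: PM. Qed.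

Lemma nfV g : nf g^-1 = winv (nf g).
Proof. by rewrite -{1}[g]nfK -weval_winv wevalK // reduced_winv nf_reduced. Qed.

(** [q] is the part that cancels. Induction on the first word from its right end: its last letter
    either meets its inverse and goes into [q], or nothing cancels at all. *)
Lemma nf_mulP g h : exists p q r,
  [/\ nf g = p ++ q, nf h = winv q ++ r & nf (g * h) = p ++ r].
Proof.
rewrite -[g in g * _]nfK -[h in _ * h]nfK.
elim/last_ind: (nf g) (nf_reduced g) (nf h) (nf_reduced h) => [|w x IH] rw v rv.
  by exists [::], [::], v; rewrite /= mul1g wevalK.
case: v rv => [|y v] rv.
  by exists (rcons w x), [::], [::]; rewrite mulg1 !cats0 wevalK.
have [E|ne] := eqVneq y (linv x).
  have rw' : reduced w by move: rw; rewrite -cats1 => /reduced_catl.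
  have [p [q [r [-> -> H]]]] := IH rw' v (path_sorted rv).
  exists p, (rcons q x), r; rewrite rcons_cat winv_rcons -E; split=> //.
  rewrite -H -rcons_cat weval_rcons /= E lvalV; congr nf.
  by rewrite -mulgA mulVKg.
exists (rcons w x), [::], (y :: v); rewrite cats0 -weval_cat; split=> //.
by rewrite wevalK // cat_rcons reduced_cat2 rw rv /nocancel ne.
Qed.

Definition wlen g := size (nf g).

Lemma wlenV g : wlen g^-1 = wlen g. Proof. by rewrite /wlen nfV size_winv. Qed.

Lemma wlen_mul g h : (wlen (g * h) <= wlen g + wlen h)%N.
Proof.
rewrite /wlen; have [p [q [r [-> -> ->]]]] := nf_mulP g h.
by rewrite !size_cat size_winv; lia.
Qed.

Lemma wlen_mulr g h : (wlen g <= wlen (g * h) + wlen h)%N.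
Proof. by have := wlen_mul (g * h) h^-1; rewrite mulgK wlenV. Qed.

Lemma wlen_mull g h : (wlen h <= wlen (g * h) + wlen g)%N.
Proof. by have := wlen_mul g^-1 (g * h); rewrite mulKg wlenV addnC. Qed.

Lemma wlen1 : wlen 1 = 0%N. Proof. by rewrite /wlen nf1. Qed.
Lemma wlen_eq0 g : wlen g = 0%N -> g = 1.
Proof. by move/size0nil => E; apply: nf_inj; rewrite E nf1. Qed.

End NormalForm.

(** * Counting quasi-morphisms *)

Section Occurrences.
Variable T : eqType.
Implicit Types (x y : T) (u v w p q : seq T).

Local Arguments prefix : simpl never.

Fixpoint occ u w : nat := if w is x :: w' then prefix u w + occ u w' else 0.

Lemma occ_cat_ge u p q : (occ u p + occ u q <= occ u (p ++ q))%N.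
Proof.
elim: p => //= x p IH.
have : (prefix u (x :: p) <= prefix u (x :: p ++ q))%N.
  by case H : (prefix u (x :: p)) => //; rewrite -cat_cons prefix_catl.
by lia.
Qed.

Lemma occ_cat_size u p q : (occ u (p ++ q) <= size p + occ u q)%N.
Proof. by elim: p => //= x p IH; have := leq_b1 (prefix u (x :: p ++ q)); lia. Qed.

Lemma occ_cat_le u p q : (occ u (p ++ q) <= occ u p + occ u q + size u)%N.
Proof.
elim: p => /= [|x p IH]; first by lia.
have [lt|le] := ltnP (size (x :: p)) (size u).
  have := occ_cat_size u p q; have := leq_b1 (prefix u (x :: p ++ q)).
  by move: lt => /=; lia.
rewrite -cat_cons !prefixE takel_cat //; by lia.
Qed.

Lemma occ_infix u w : (0 < occ u w)%N -> infix u w.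
Proof.
elim: w => //= x w IH; case: (prefix u (x :: w)) => //.
Qed.

Lemma prefix_rconsE u v x : prefix u (rcons v x) = prefix u v || (u == rcons v x).
Proof.
apply/idP/orP => [/prefixP[s]|[/prefixP[s ->]|/eqP <-]].
- case/lastP: s => [|s y]; first by rewrite cats0 => ->; right.
  by rewrite -rcons_cat => /rcons_inj[-> _]; left; exact: prefix_prefix.
- by rewrite rcons_cat prefix_prefix.
- exact: prefix_refl.
Qed.

Lemma suffix_consE u v x : suffix u (x :: v) = suffix u v || (u == x :: v).
Proof.
rewrite -prefix_rev rev_cons prefix_rconsE prefix_rev; congr orb.
by rewrite -rev_cons (inj_eq (can_inj revK)).
Qed.

(** Occurrences are counted by their ends instead of their starts; this gives the invariance under
    reversal. *)
Lemma occ_rcons u w x : u != [::] ->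
  occ u (rcons w x) = (occ u w + suffix u (rcons w x))%N.
Proof.
move=> u0; elim: w => [|y w IH].
  by rewrite /= prefixs1 suffix_consE suffixs0 (negbTE u0) addn0.
rewrite rcons_cons /= IH -rcons_cons prefix_rconsE rcons_cons suffix_consE.
case: eqP => [->|_]; last by rewrite !orbF; lia.
rewrite !orbT; case H: (prefix _ _).
  by have := size_prefix H; rewrite /= size_rcons; lia.
case H': (suffix _ _); last by lia.
by have := size_suffix H'; rewrite /= size_rcons; lia.
Qed.

Lemma occ_rev u w : u != [::] -> occ (rev u) (rev w) = occ u w.
Proof.
move=> u0; elim: w => [//|x w IH]; rewrite rev_cons occ_rcons.
  by rewrite IH -rev_cons suffix_rev addnC.
by apply: contra u0 => /eqP/(congr1 rev); rewrite revK => ->.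
Qed.

Lemma occ_map f u w : injective f -> occ (map f u) (map f w) = occ u w.
Proof.
move=> fI; elim: w => //= x w ->; congr (_ + _)%N; congr nat_of_bool.
by rewrite -map_cons !prefixE size_map -map_take (inj_eq (inj_map fI)).
Qed.

End Occurrences.

(* The Brooks counting quasi-morphism of the word [u]. *)
Section Counting.
Variables (n : nat) (u : seq (letter n)).
Hypothesis u0 : u != [::].

Definition hword w : int := ((occ u w)%:Z - (occ (winv u) w)%:Z)%R.

Lemma hword_winv w : hword (winv w) = (- hword w)%R.
Proof.
have H v p : v != [::] -> occ (winv v) (winv p) = occ v p :> nat.
  move=> v0; rewrite /winv occ_rev ?occ_map //; first exact: linv_inj.
  by move: v0; rewrite -!size_eq0 size_map.
have u0' : winv u != [::] by rewrite -size_eq0 size_winv size_eq0.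
rewrite /hword -{1}[u]winvK !H //; lia.
Qed.

Lemma hword_cat p q : (absz (hword (p ++ q) - hword p - hword q)%R <= size u)%N.
Proof.
rewrite /hword; have := occ_cat_ge u p q; have := occ_cat_le u p q.
have := occ_cat_ge (winv u) p q; have := occ_cat_le (winv u) p q.
by rewrite size_winv; set k := size u; lia.
Qed.

Variables (F : groupType) (b : 'I_n -> F) (hb : is_basis b).

Definition hq (g : F) : int := hword (nf hb g).

(** With [q] the cancelled part, the seams of [p ++ q], [winv q ++ r] and [p ++ r] cost [size u]
    each, and the two contributions of [q] cancel by antisymmetry. *)
Lemma hq_mul (g h : F) : (absz (hq (g * h)%g - hq g - hq h)%R <= 3 * size u)%N.
Proof.
rewrite /hq; have [p [q [r [-> -> ->]]]] := nf_mulP hb g h.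
have := hword_cat p q; have := hword_cat p r; have := hword_cat (winv q) r.
rewrite hword_winv; move: (hword (p ++ q)) (hword (p ++ r)) (hword (winv q ++ r)).
by move: (hword p) (hword q) (hword r) (size u) => *; lia.
Qed.

Lemma hq_eq0 (g : F) : ~~ infix u (nf hb g) -> ~~ infix (winv u) (nf hb g) -> hq g = 0%R.
Proof.
rewrite /hq /hword => /(contraNN (@occ_infix _ _ _)) H1 /(contraNN (@occ_infix _ _ _)) H2.
by lia.
Qed.

End Counting.

(** * Whitehead's cut vertex lemma *)

(* [lia] does not identify convertible instances of [wlen]. *)
Ltac len_lia := repeat match goal with |- context [@wlen ?F ?n ?b ?h ?x] =>
  let t := constr:(@wlen F n b h x) in
  let y := fresh "y" in set y := t; clearbody y end; lia.

Section CyclicWords.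
Variables (F : groupType) (n : nat) (b : 'I_n -> F) (hb : is_basis b).
Implicit Types (x y d : letter n) (k w v : seq (letter n)) (g p c : F).

Local Notation nf := (nf hb).
Local Notation wlen := (wlen hb).
Local Notation weval := (weval b).

Definition cyc_reduced k := (k != [::]) && cycle (@nocancel n) k.

Lemma cyc_reduced_cat k : cyc_reduced k -> reduced (k ++ k).
Proof.
case: k => [//|x k] /=; rewrite /cyc_reduced /= cat_path rcons_path => /andP[p] /= ->.
by rewrite p.
Qed.

Lemma cyc_reducedE k : k != [::] -> cyc_reduced k = reduced (k ++ k).
Proof.
case: k => [//|x k] _ /=; rewrite /cyc_reduced /= cat_path rcons_path /=.
by case: (path _ x k); rewrite ?andbT.
Qed.

Lemma cyc_reduced_winv k : cyc_reduced (winv k) = cyc_reduced k.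
Proof.
have [->//|k0] := eqVneq k [::].
have k0' : winv k != [::] by rewrite -size_eq0 size_winv size_eq0.
by rewrite !cyc_reducedE // -winv_cat reduced_winv.
Qed.

Lemma cyc_reduced_rot i k : cyc_reduced (rot i k) = cyc_reduced k.
Proof.
rewrite /cyc_reduced rot_cycle; congr (_ && _).
by rewrite -!size_eq0 size_rot.
Qed.

Lemma reduced_glue w x k v : reduced (w ++ x :: k) -> reduced ((x :: k) ++ v) ->
  reduced (w ++ (x :: k) ++ v).
Proof.
case: w => [//|y w]; rewrite /= !cat_path /= cat_path /= => /and3P[-> ->] /= _.
by move=> ->.
Qed.

(** The only letter that cannot follow [w]: the direction from the vertex [weval w] of the Cayley
    tree back to the root, and none at the root itself. *)
Definition backward w := if w is x :: w' then Some (linv (last x w')) else None.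

Lemma backwardP w d v : reduced w ->
  reduced (w ++ d :: v) = reduced (d :: v) && (Some d != backward w).
Proof.
case: w => [|x w] rw; first by rewrite andbT.
by rewrite /reduced /= cat_path /= andbC -andbA andbC (rw : path _ _ _) andbT andbC.
Qed.

Lemma reduced_pow w k m : cyc_reduced k -> reduced (w ++ k) ->
  reduced (w ++ flatten (nseq m.+1 k)).
Proof.
move=> ck; have := cyc_reduced_cat ck; case: k ck => // x k ck rk.
elim: m w => [|m IH] w rw; first by rewrite /= cats0.
rewrite [nseq _ _]/= [flatten _]/=; apply: reduced_glue => //.
exact: IH rk.
Qed.

Lemma weval_pow k m : weval (flatten (nseq m k)) = weval k ^+ m.
Proof. by elim: m => //= m IH; rewrite weval_cat IH expgS. Qed.

Lemma size_pow k m : size (flatten (nseq m k)) = (m * size k)%N.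
Proof. by elim: m => //= m IH; rewrite size_cat IH mulSn. Qed.

Lemma wlen_pow k m : cyc_reduced k -> (m <= wlen (weval k ^+ m))%N.
Proof.
case: m => [//|m] ck; have := reduced_pow m ck (w := [::]) => /(_ _).
rewrite -weval_pow /wlen /= => H; rewrite wevalK; last first.
  by apply: H; have := cyc_reduced_cat ck => /reduced_catl.
rewrite -[_ ++ _]/(flatten (nseq m.+1 k)) size_pow leq_pmulr //.
by case: k ck {H}.
Qed.

(** Induction on the length: unless the normal form is cyclically reduced, its ends are inverse
    letters and a conjugation strips them off. *)
Lemma cyclic_conj g : g <> 1 -> exists p k, cyc_reduced k /\ g = weval k ^ p.
Proof.
have [m le] := ubnP (wlen g); elim: m g le => // m IH g; rewrite ltnS => le g1.
have [ck|] := boolP (cyc_reduced (nf g)).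
  by exists 1, (nf g); rewrite conjg1 nfK.
have nf0 : nf g != [::].
  by apply/eqP => E; apply: g1; apply: (@wlen_eq0 _ _ _ hb); rewrite /wlen E.
case E : (nf g) (nf_reduced hb g) nf0 => [//|x w] rw _.
move: (rw); rewrite /reduced /= /cyc_reduced /= rcons_path => ->.
rewrite /= negbK => /eqP; case/lastP: w E rw => [|w y] E rw.
  by move=> /= /esym/eqP; rewrite (negbTE (linv_neq x)).
rewrite last_rcons => xE; have yE : y = linv x by rewrite xE linvK.
have gE : weval w = g ^ lval b x.
  by rewrite -[g](nfK hb) E /= weval_rcons yE lvalV conjgE !mulgA mulVg mul1g mulgVK.
have rw' : reduced w by move: rw; rewrite -cats1 -cat_cons => /reduced_catl/path_sorted.
have [||p [k [ck EE]]] := IH (g ^ lval b x).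
- by rewrite -gE /wlen wevalK //; move: le; rewrite /wlen E /= size_rcons; lia.
- by move=> /eqP; rewrite conjg_eq1 => /eqP.
exists (p * (lval b x)^-1), k; split=> //.
by rewrite conjgM -EE conjgK.
Qed.

Lemma pow_long g : g <> 1 -> exists N, forall m, (m <= wlen (g ^+ m) + N)%N.
Proof.
move=> /cyclic_conj[p [k [ck ->]]]; exists (wlen p + wlen p)%N => m.
rewrite -conjXg; have := wlen_pow m ck.
have := wlen_mull hb p^-1 (weval k ^+ m * p); have := wlen_mulr hb (weval k ^+ m) p.
rewrite -conjgE wlenV; len_lia.
Qed.

End CyclicWords.

(** * The colouring of the Cayley tree given by a free splitting *)

Section Coloring.
Variables (F : groupType) (n : nat) (b : 'I_n -> F) (hb : is_basis b).
Implicit Types (x y d : letter n) (k w v : seq (letter n)) (g p c h : F).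
Variables (C D : set F).
Hypothesis fCD : free_product2 C D.

Local Notation nf := (nf hb).
Local Notation wlen := (wlen hb).
Local Notation weval := (weval b).

(** The elements that fix a vertex of the Bass-Serre tree of [C * D]. *)
Definition elliptic g := exists p, C (g ^ p) \/ D (g ^ p).

Lemma elliptic_conj g p : elliptic g -> elliptic (g ^ p).
Proof. by case=> q H; exists (p^-1 * q); rewrite -conjgM mulVKg. Qed.

Let sC : is_subgroup C := fCD.1 true.
Let sD : is_subgroup D := fCD.1 false.

Lemma ellipticV g : elliptic g -> elliptic g^-1.
Proof. by case=> q H; exists q; rewrite conjVg; case: H => H; [left|right]; exact: sgV. Qed.

Lemma sgX (A : set F) g m : is_subgroup A -> A g -> A (g ^+ m).
Proof.
by move=> sA Ag; elim: m => [|m IH]; [exact: sg1|rewrite expgS; exact: sgM].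
Qed.

Lemma ellipticX g m : elliptic g -> elliptic (g ^+ m).
Proof. by case=> q H; exists q; rewrite conjXg; case: H => H; [left|right]; exact: sgX. Qed.

Definition rtrans g : sym (F * bool).
Proof.
exists (fun z => (z.1 * g^-1, z.2)) (fun z => (z.1 * g, z.2)).
- by move=> [h e] /=; rewrite mulgVK.
- by move=> [h e] /=; rewrite mulgK.
Defined.

Lemma rtrans_hom : is_hom rtrans.
Proof. by move=> x y; apply: sym_eqP => -[h e] /=; rewrite invgM mulgA. Qed.

(** Right translation conjugated by the exchange of the two sheets over [1]: the sheet changes when
    exactly one of [h] and [h * g^-1] is [1]. Letting [C] act in this way and [D] without the twist
    records the steps by which [C] leaves [1] or returns to it. *)
Definition twist g := flip [set 1] * rtrans g * (flip [set 1])^-1.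

Lemma twistE g h e :
  twist g (h, e) = (h * g^-1, e (+) (h == 1) (+) (h * g^-1 == 1)).
Proof.
by congr pair; rewrite /=; congr (_ (+) _ (+) _); apply/idP/eqP => [/asboolP|/asboolP].
Qed.

Lemma twist_hom : is_hom twist.
Proof. by move=> x y; rewrite /twist rtrans_hom !mulgA mulgVK. Qed.

Lemma twisted_action : exists rho : F -> sym (F * bool),
  [/\ is_hom rho, forall c, C c -> rho c = twist c & forall c, D c -> rho c = rtrans c].
Proof.
have [|f [[hf fE] _]] := fCD.2 (sym (F * bool)) (pairfam twist rtrans).
  by case=> x y _ _; [exact: twist_hom|exact: rtrans_hom].
by exists f; split=> // c Cc; [exact: (fE true)|exact: (fE false)].
Qed.

Definition rho := sval (cid twisted_action).

Lemma rho_hom : is_hom rho. Proof. by rewrite /rho; case: cid => ? []. Qed.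
Lemma rhoC c : C c -> rho c = twist c. Proof. by rewrite /rho; case: cid => ? [] /= ? H ?; apply: H. Qed.
Lemma rhoD c : D c -> rho c = rtrans c. Proof. by rewrite /rho; case: cid => ? [] /= ? ? H; apply: H. Qed.

(** The elements that act by right translation with sheet changes only at bounded length form a
    subgroup containing both factors. *)
Lemma rho_support g : exists s : F -> bool,
  (forall h e, rho g (h, e) = (h * g^-1, e (+) s h)) /\
  exists L, forall h, (L <= wlen h)%N -> s h = false.
Proof.
pose K : set F := [set g | exists s : F -> bool,
  (forall h e, rho g (h, e) = (h * g^-1, e (+) s h)) /\
  exists L, forall h, (L <= wlen h)%N -> s h = false].
have KM (x y : F) : K x -> K y -> K (x * y).
  move=> [s [sE [L sL]]] [s' [s'E [L' s'L]]].
  exists (fun h => s' h (+) s (h * y^-1)); split.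
    by move=> h e; rewrite rho_hom symM s'E sE invgM mulgA addbA.
  exists (L + L' + wlen y)%N => h le; rewrite s'L ?sL //.
    by have := wlen_mulr hb h y^-1; rewrite wlenV; move: le; len_lia.
  by move: le; len_lia.
have KV (x : F) : K x -> K x^-1.
  move=> [s [sE [L sL]]]; exists (fun h => s (h * x)); split.
    move=> h e; rewrite invgK; have : rho (x * x^-1) (h * x * x^-1, e (+) s (h * x) (+) s (h * x)) = (h, e).
      by rewrite mulgV (hom1 rho_hom) mulgK -addbA addbb addbF.
    rewrite mulgK -addbA addbb addbF => _.
    have : rho x^-1 (rho x (h * x, e (+) s (h * x))) = (h * x, e (+) s (h * x)).
      by rewrite -symM -rho_hom mulVg (hom1 rho_hom).
    by rewrite sE mulgK -addbA addbb addbF.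
  by exists (L + wlen x)%N => h le; apply: sL; have := wlen_mulr hb h x; lia.
apply: (@free_product_full _ _ _ K fCD).
  split=> [|x y Kx Ky]; last by apply: KM => //; apply: KV.
  exists (fun=> false); split; last by exists 0%N.
  by move=> h e; rewrite (hom1 rho_hom) invg1 mulg1 addbF.
case=> x Ax; rewrite /= in Ax.
  exists (fun h => (h == 1) (+) (h * x^-1 == 1)); split.
    by move=> h e; rewrite rhoC // twistE addbA.
  exists (wlen x).+1 => h le; apply/negbTE.
  rewrite divg_eq1; case: eqP le => [->|_]; first by rewrite wlen1.
  by case: eqP => // ->; rewrite ltnn.
by exists (fun=> false); split; [move=> h e; rewrite rhoD //= addbF|exists 0%N].
Qed.

(* It tells whether the normal form of [g] in [C * D] starts in [C]. *)
Definition color g : bool := (rho g^-1 (1, false)).2.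

Lemma rho_color g : rho g^-1 (1, false) = (g, color g).
Proof.
have [s [sE _]] := rho_support g^-1.
by rewrite /color sE /= mul1g invgK.
Qed.

Lemma color_mul g h : color (g * h) = (rho h^-1 (g, color g)).2.
Proof. by rewrite /color invgM rho_hom symM rho_color. Qed.

(** The colour is almost invariant under right multiplication, hence eventually constant towards
    every end of the Cayley tree. *)
Lemma color_almost_inv h : exists L, forall g, (L <= wlen g)%N -> color (g * h) = color g.
Proof.
have [s [sE [L sL]]] := rho_support h^-1; exists L => g le.
by rewrite color_mul sE /= sL // addbF.
Qed.

Lemma color_mulD g c : D c -> color (g * c) = color g.
Proof. by move=> Dc; rewrite color_mul rhoD //; exact: sgV. Qed.

Lemma color_mulC g c : C c -> color (g * c) = color g (+) (g == 1) (+) (g * c == 1).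
Proof. by move=> Cc; rewrite color_mul rhoC ?twistE ?invgK //; exact: sgV. Qed.

Lemma color1 : color 1 = false.
Proof. by rewrite /color invg1 (hom1 rho_hom). Qed.

(** Up to a factor [p^-1] on the right, which does not affect the colour of long elements, both rays
    stay in one coset of [C] or of [D], and on such a coset the colour is constant away from [1]. *)
Lemma color_line k g : cyc_reduced k -> elliptic (weval k) ->
  exists M, forall m, (M <= m)%N -> color (g * weval k ^+ m) = color (g * (weval k)^-1 ^+ m).
Proof.
move=> ck [p ell]; set e := weval k in ell *.
have [L inv] := color_almost_inv p^-1.
(* The two copies of [wlen p] pay for the conjugation by [p]. The rest keeps the power longer than
   [L] after multiplication by [g * p], and different from [(g * p)^-1]. *)
exists (L + wlen (g * p) + wlen p + wlen p).+1 => m le.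
have E a : g * a ^+ m = g * p * (a ^ p) ^+ m * p^-1.
  by rewrite -conjXg conjgE !mulgA mulgK mulgK.
have long a : (m <= wlen (a ^+ m))%N -> (L + wlen (g * p) < wlen ((a ^ p) ^+ m))%N.
  rewrite -conjXg => lea; have := wlen_mull hb p^-1 (a ^+ m * p).
  have := wlen_mulr hb (a ^+ m) p; rewrite -conjgE wlenV; move: le lea; len_lia.
have {}long : (L + wlen (g * p) < wlen ((e ^ p) ^+ m))%N /\
              (L + wlen (g * p) < wlen ((e^-1 ^ p) ^+ m))%N.
  split; apply: long; first exact: wlen_pow.
  by rewrite /e -weval_winv; apply: wlen_pow; rewrite cyc_reduced_winv.
have simp a : (L + wlen (g * p) < wlen ((a ^ p) ^+ m))%N ->
    color (g * a ^+ m) = color (g * p * (a ^ p) ^+ m).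
  by move=> lt; rewrite E inv //; have := wlen_mull hb (g * p) ((a ^ p) ^+ m); move: lt; len_lia.
have ne c : (L + wlen (g * p) < wlen c)%N -> (g * p * c == 1) = false.
  move=> lt; apply/negbTE/eqP => H; have : c = (g * p)^-1.
    by apply: (@mulgI _ (g * p)); rewrite H mulgV.
  by move=> cE; move: lt; rewrite cE wlenV; len_lia.
rewrite !simp ?(long.1) ?(long.2) //; case: ell => H.
- have HV : C (e^-1 ^ p) by rewrite conjVg; apply: sgV.
  have HX := sgX m sC H; have HVX := sgX m sC HV.
  by rewrite (color_mulC _ HX) (color_mulC _ HVX) !ne ?(long.1) ?(long.2).
- have HV : D (e^-1 ^ p) by rewrite conjVg; apply: sgV.
  have HX := sgX m sD H; have HVX := sgX m sD HV.
  by rewrite (color_mulD _ HX) (color_mulD _ HVX).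
Qed.

(** Powers of an element of [D] keep the colour of [1], nontrivial powers of an element of [C] have
    the opposite one, and both become arbitrarily long. *)
Lemma color_not_const : nontrivial C -> nontrivial D ->
  forall L (e : bool), exists g, (L <= wlen g)%N /\ color g <> e.
Proof.
move=> [c Cc c1] [d Dd d1] L; case.
- have [N long] := pow_long hb d1; exists (d ^+ (L + N)); split.
    by have := long (L + N)%N; len_lia.
  by rewrite -[d ^+ _]mul1g color_mulD ?color1 //; exact: sgX.
- have [N long] := pow_long hb c1; exists (c ^+ (L + N).+1); split.
    by have := long (L + N).+1; len_lia.
  rewrite -[c ^+ _]mul1g color_mulC ?color1 ?eqxx ?mul1g; last exact: sgX.
  case: eqP => // E; have := long (L + N).+1; rewrite E wlen1; lia.
Qed.

(* The Whitehead graph of all elements conjugate into [C] or [D]: the pair [d, d']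
   is an edge when the axis of such an element leaves a vertex of the Cayley tree
   along [d] and [d']. *)
Definition whitehead d d' := exists k,
  [/\ cyc_reduced (d' :: k), last d' k = linv d & elliptic (weval (d' :: k))].

Lemma whitehead_sym d d' : whitehead d d' -> whitehead d' d.
Proof.
move=> [k [ck lk ek]]; have E : winv (d' :: k) = d :: behead (winv (d' :: k)).
  case/lastP: k lk {ck ek} => [/= ->|k y]; first by rewrite /winv /= linvK.
  by rewrite last_rcons => ->; rewrite -rcons_cons winv_rcons /= linvK.
exists (behead (winv (d' :: k))); rewrite -E; split.
- by rewrite cyc_reduced_winv.
- by move: E; rewrite winv_cons; case: (winv k) => [[<-]|z s] //=; rewrite last_rcons.
- by rewrite weval_winv; apply: ellipticV.
Qed.

(** There are finitely many letters, so one bound serves them all; beyond it no further letter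
    changes the colour. *)
Lemma color_cone : exists L, forall w v, reduced (w ++ v) -> (L <= size w)%N ->
  color (weval (w ++ v)) = color (weval w).
Proof.
have [Lf LfP] := choice (fun x => color_almost_inv (lval b x)).
exists (\max_x Lf x) => w v rv le; elim/last_ind: v rv => [|v x IH]; first by rewrite cats0.
rewrite -rcons_cat => r; have r' : reduced (w ++ v) by move: r; rewrite -cats1 => /reduced_catl.
rewrite weval_rcons LfP ?IH // /wlen wevalK // size_cat.
by apply: leq_trans (leq_trans le (leq_addr _ _)); apply: leq_bigmax.
Qed.

(* Whitehead's cut vertex lemma: a cone of the Cayley tree whose sub-cones all have an
   almost constant colour has an almost constant colour itself, because the sub-cones
   are joined by axes, along which the colours at both ends agree; hence the colouring
   would be almost constant. *)
Lemma cut_vertex : nontrivial C -> nontrivial D ->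
  ~ forall (v : option (letter n)) (col : letter n -> bool),
    (forall d d', whitehead d d' -> Some d <> v -> Some d' <> v -> col d = col d') ->
    forall d d', Some d <> v -> Some d' <> v -> col d = col d'.
Proof.
move=> nC nD conn; have [L cone] := color_cone.
pose mono w := exists e : bool, forall v, reduced (w ++ v) -> (L <= size (w ++ v))%N ->
  color (weval (w ++ v)) = e.
suff [c monoc] : mono [::].
  have [g [le]] := color_not_const nC nD L c; apply.
  by rewrite -[g](nfK hb); apply: (monoc (nf g)) => //; exact: nf_reduced.
(* Induction from the leaves to the root: cones at depth [L] have constant colour by [color_cone],
   and the cone of the root is everything. *)
suff H j : forall w, reduced w -> (L <= size w + j)%N -> mono w by exact: (H L).
elim: j => [|j IH] w rw.
  by rewrite addn0 => le; exists (color (weval w)) => v rv _; exact: cone.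
move=> le; have [leL|ltL] := leqP L (size w).
  by exists (color (weval w)) => v rv _; exact: cone.
(* The removed vertex is the direction back to the root; every other letter opens a sub-cone. *)
pose v0 := backward w.
have v0P d s : reduced (d :: s) -> Some d <> v0 -> reduced (w ++ d :: s).
  by move=> rd ne; rewrite backwardP // rd; apply/eqP.
have v0P' d s : reduced (w ++ d :: s) -> Some d <> v0.
  by rewrite backwardP // => /andP[_ /eqP].
(* [col] is the colour of each sub-cone; nothing is required of it at the backward letter. *)
have /choice[col colP] d : exists e : bool, Some d <> v0 ->
    forall v, reduced (rcons w d ++ v) -> (L <= size (rcons w d ++ v))%N ->
    color (weval (rcons w d ++ v)) = e.
  have [->|/eqP ne] := eqVneq (Some d) v0; first by exists true.
  have [||c H] := IH (rcons w d); last by exists c.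
    by rewrite -cats1; apply: v0P.
  by rewrite size_rcons addSn -addnS.
have edge d d' : whitehead d d' -> Some d <> v0 -> Some d' <> v0 -> col d = col d'.
  move=> Wdd' nd nd'.
  (* The ray from [weval w] along the powers of a cyclically reduced word stays in the sub-cone of
     its first letter. *)
  have side k d1 m : cyc_reduced (d1 :: k) -> Some d1 <> v0 -> (L <= m)%N ->
      color (weval w * weval (d1 :: k) ^+ m.+1) = col d1.
    move=> ck n1 leL; rewrite -weval_pow -weval_cat.
    have r : reduced (w ++ flatten (nseq m.+1 (d1 :: k))).
      apply: reduced_pow => //; apply: v0P => //.
      by have := cyc_reduced_cat ck => /reduced_catl.
    have le' : (L <= size (w ++ flatten (nseq m.+1 (d1 :: k))))%N.
      by rewrite size_cat size_pow /=; nia.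
    by move: r le'; rewrite /= -cat_rcons => r le'; apply: colP.
  have [k [ck lk ek]] := Wdd'.
  have [M line] := color_line (weval w) ck ek.
  have Ew : winv (d' :: k) = d :: behead (winv (d' :: k)).
    case/lastP: k lk {ck ek line} => [/= ->|k y]; first by rewrite /winv /= linvK.
    by rewrite last_rcons => ->; rewrite -rcons_cons winv_rcons /= linvK.
  have ck' : cyc_reduced (d :: behead (winv (d' :: k))) by rewrite -Ew cyc_reduced_winv.
  (* The inverse word follows the same axis in direction [d]. The exponent is large enough both for
     the two ends to agree in colour and for both to lie at depth [L]. *)
  have := line (L + M).+1; rewrite -weval_winv Ew.
  by rewrite !side ?leq_addr // => -> //; rewrite leqW // leq_addl.
have colE := conn v0 col edge.
have [[d0 n0]|none] := pselect (exists d0, Some d0 <> v0).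
  exists (col d0) => v; case: v => [|d v] rv lev; first by move: lev; rewrite cats0; lia.
  rewrite (colE d0 d) ?(v0P' _ _ rv) //; last exact: v0P' rv.
  by move: rv lev; rewrite -cat_rcons => rv lev; apply: colP => //; apply: (v0P' d v); rewrite -cat_rcons.
exists true => v; case: v => [|d v] rv lev; first by move: lev; rewrite cats0; lia.
by case: none; exists d; exact: v0P' rv.
Qed.

End Coloring.

(** * Arcs of a free splitting *)

Section Syllables.
Variables (F : groupType) (m : nat) (b : 'I_m.+1 -> F) (hb : is_basis b).
Implicit Types (x y d : letter m.+1) (w v : seq (letter m.+1)) (g p c : F).
Implicit Types (s : bool * F) (L : seq (bool * F)) (e : bool) (r : pred 'I_m.+1).

Local Notation nf := (nf hb).
Local Notation wlen := (wlen hb).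
Local Notation weval := (weval b).
Local Notation tl e := ((ord_max, e) : letter m.+1).
Local Notation tpow e := (lval b (tl e)).

Definition instd r g : bool := all (fun x => r x.1) (nf g).

Lemma instd1 r : instd r 1. Proof. by rewrite /instd nf1. Qed.

Lemma all_winv r w : all (fun x => r x.1) (winv w) = all (fun x => r x.1) w.
Proof. by rewrite /winv all_rev all_map. Qed.

Lemma instdV r g : instd r g^-1 = instd r g.
Proof. by rewrite /instd nfV all_winv. Qed.

Lemma instdM r g c : instd r g -> instd r c -> instd r (g * c).
Proof.
rewrite /instd; have [w [v [z [-> -> ->]]]] := nf_mulP hb g c.
by rewrite !all_cat => /andP[-> _] /andP[_ ->].
Qed.

Lemma instd_sg r : is_subgroup [set g | instd r g].
Proof.
by split=> [|x y /= rx ry]; [exact: instd1|apply: instdM => //; rewrite instdV].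
Qed.

Lemma instd_lval r x : instd r (lval b x) = r x.1.
Proof.
have : reduced [:: x] by [].
by move/(wevalK hb); rewrite /= mulg1 /instd => -> /=; rewrite andbT.
Qed.

Lemma instd_b r i : instd r (b i) = r i.
Proof. exact: (instd_lval r (i, true)). Qed.

(* Subgroup generated by all basis elements but the last one, [t]. *)
Definition inA := instd (predC1 ord_max).

(** A syllable [(e, c)] stands for [t] or its inverse, according to the sign [e], followed by the
    arc [c]. *)
Definition sprod L : F := foldr (fun s g => tpow s.1 * (s.2 * g)) 1 L.
Definition arcs_in L := all (fun s => inA s.2) L.
Definition nxt L e := if L is s :: _ then s.1 else e.
(** Britton's condition: no trivial arc between opposite powers of [t]. The argument [e] is the sign
    of the power of [t] after the list; with the first sign of the list itself the condition becomes
    cyclic. *)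
Fixpoint good L e := if L is s :: L' then ((s.1 == nxt L' e) || (s.2 != 1)) && good L' e else true.
Definition sword L : seq (letter m.+1) := flatten [seq tl s.1 :: nf s.2 | s <- L].

Lemma nxt_cat L L' e : nxt (L ++ L') e = nxt L (nxt L' e).
Proof. by case: L. Qed.

Lemma good_cat L L' e : good (L ++ L') e = good L (nxt L' e) && good L' e.
Proof. by elim: L => //= s L ->; rewrite nxt_cat andbA. Qed.

Lemma sprod_cat L L' : sprod (L ++ L') = sprod L * sprod L'.
Proof. by elim: L => [|s L IH] /=; rewrite ?mul1g // IH !mulgA. Qed.

Lemma weval_sword L : weval (sword L) = sprod L.
Proof.
by elim: L => //= s L IH; rewrite /sword /= weval_cat -/(sword L) IH (nfK hb).
Qed.

Lemma reduced_sword L e : arcs_in L -> good L e -> reduced (rcons (sword L) (tl e)).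
Proof.
elim: L => // s L IH /andP[sA AL] /andP[sn gL]; have {IH} := IH AL gL.
have -> : rcons (sword (s :: L)) (tl e) = tl s.1 :: nf s.2 ++ rcons (sword L) (tl e).
  by rewrite /sword /= -cats1 -catA cats1.
have : ohead (rcons (sword L) (tl e)) = Some (tl (nxt L e)) by case: L {AL sn gL}.
case: (rcons _ _) => // z X [->] rX.
have := nf_reduced hb s.2; move: sA; rewrite /inA /instd.
case/lastP E : (nf s.2) => [|w y].
  have s1 : s.2 = 1 by apply: (@wlen_eq0 _ _ _ hb); rewrite /wlen E.
  move: sn; rewrite s1 eqxx orbF => /eqP -> _ _; rewrite cat0s reduced_cons rX andbT.
  by apply/eqP => -[]; case: (nxt _ _).
rewrite all_rcons => /andP[ymax wA] rw; rewrite /= in ymax wA.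
rewrite -cat_cons -rcons_cons cat_rcons.
rewrite reduced_cat2 rX andbT; apply/andP; split; last first.
  by apply/eqP => -[/eqP]; rewrite eq_sym (negbTE ymax).
rewrite rcons_cons reduced_cons rw andbT.
case: w wA {rw E} => [|y' w] /=; last first.
  by move=> /andP[/negbTE zm _]; apply/eqP => -[zE]; move: zm; rewrite zE eqxx.
by move=> _; apply/eqP => -[zE]; move: ymax; rewrite zE eqxx.
Qed.

(** The cyclic word is rotated so that [t g t] comes first; hence it closes up with the sign
    [true]. *)
Definition arcset (Ell : F -> Prop) g := exists c L,
  [/\ arcs_in ((true, g) :: (true, c) :: L), good ((true, g) :: (true, c) :: L) true
    & Ell (sprod ((true, g) :: (true, c) :: L))].

Section Twist.
Variables (x y : F) (theta : F -> F).
Hypotheses (Ax : inA x) (Ay : inA y) (htheta : is_hom theta).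
Hypotheses (thetaA : forall g, inA g -> theta g = g) (thetat : theta (tpow true) = x * tpow true * y).

Definition pre e := if e then x else y^-1.
Definition post e := if e then y else x^-1.
Fixpoint tw L e := if L is s :: L' then (s.1, post s.1 * s.2 * pre (nxt L' e)) :: tw L' e else [::].

Lemma theta_tpow e : theta (tpow e) = pre e * tpow e * post e.
Proof.
case: e; first exact: thetat.
have -> : tpow false = (tpow true)^-1 by rewrite -lvalV.
by rewrite homV // thetat !invgM mulgA.
Qed.

Lemma nxt_tw L e e' : nxt (tw L e) e' = nxt L e'. Proof. by case: L. Qed.

(** Between two powers of [t] the factors [post] and [pre] are absorbed by the arc, so that only the
    outermost [pre] on either side remains. *)
Lemma tw_prod L e : arcs_in L -> pre (nxt L e) * sprod (tw L e) = theta (sprod L) * pre e.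
Proof.
elim: L => [|s L IH] /=; first by rewrite (hom1 htheta) mulg1 mul1g.
move=> /andP[sA /IH E]; rewrite !htheta theta_tpow (thetaA sA) -!mulgA -E.
by rewrite !mulgA.
Qed.

(** An arc between opposite signs is merely conjugated, because [pre (~~ e)] is the inverse of
    [post e]; it becomes trivial only if it was trivial before. *)
Lemma tw_good L e : good L e -> good (tw L e) e.
Proof.
elim: L => //= s L IH /andP[H /IH ->]; rewrite andbT nxt_tw.
case: eqP H => //= /eqP ne s1; apply: contra s1 => /eqP E.
have -> : s.2 = (post s.1)^-1 * (post s.1 * s.2 * pre (nxt L e)) * (pre (nxt L e))^-1.
  by rewrite !mulgA mulVg mul1g mulgK.
rewrite E mulg1; have -> : nxt L e = ~~ s.1 by case: (s.1) ne; case: (nxt L e).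
by case: (s.1); rewrite /= ?invgK ?mulVg ?mulgV.
Qed.

Lemma tw_arcs L e : arcs_in L -> arcs_in (tw L e).
Proof.
have pA a : inA (pre a) by case: a; rewrite /= /inA ?instdV.
have qA a : inA (post a) by case: a; rewrite /= /inA ?instdV.
by elim: L => //= s L IH /andP[sA /IH ->]; rewrite andbT; apply/instdM/pA/instdM.
Qed.

Lemma arcset_twist (Ell Ell' : F -> Prop) g : (forall h, Ell h -> Ell' (theta h)) ->
  (forall h p, Ell' h -> Ell' (h ^ p)) -> arcset Ell g -> arcset Ell' (y * g * x).
Proof.
move=> HE HC [c [L [AL gL El]]]; set L0 := _ :: _ :: L in AL gL El.
exists (y * c * pre (nxt L true)), (tw L true).
have -> : (true, y * g * x) :: (true, y * c * pre (nxt L true)) :: tw L true = tw L0 true by [].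
split; [exact: tw_arcs|exact: tw_good|].
have E : x * sprod (tw L0 true) = theta (sprod L0) * x := tw_prod true AL.
have -> : sprod (tw L0 true) = theta (sprod L0) ^ x by rewrite conjgE -E mulKg.
exact/HC/HE.
Qed.

End Twist.

Lemma twist_aut g h : inA g -> inA h -> exists theta : F -> F,
  [/\ is_aut theta, forall c, inA c -> theta c = c & theta (tpow true) = g * tpow true * h].
Proof.
have ex (x y : F) : exists f : F -> F,
    is_hom f /\ forall i, f (b i) = if i == ord_max then x * b i * y else b i.
  exact: (basis_ext hb (fun i => if i == ord_max then x * b i * y else b i)).
have fixA (x y : F) f : is_hom f ->
    (forall i, f (b i) = if i == ord_max then x * b i * y else b i) ->
    forall c, inA c -> f c = c.
  move=> hf fE c; rewrite /inA /instd -{2 3}[c](nfK hb); elim: (nf c) => [|z w IH] /=.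
    by rewrite (hom1 hf).
  move=> /andP[/negbTE zm /IH E]; rewrite hf E; congr (_ * _).
  by rewrite /lval; case: (z.2); rewrite ?homV // fE zm.
have inv (x y : F) f f' : inA x -> inA y -> is_hom f -> is_hom f' ->
    (forall i, f (b i) = if i == ord_max then x * b i * y else b i) ->
    (forall i, f' (b i) = if i == ord_max then x^-1 * b i * y^-1 else b i) ->
    cancel f f'.
  move=> Ax Ay hf hf' fE f'E; suff E : f' \o f = id by move=> z; rewrite -[RHS](congr1 (@^~ z) E).
  apply: (basis_uniq hb) => //; first exact: is_hom_comp.
  move=> i /=; rewrite fE; case: eqP => [->|/eqP/negbTE ne]; last by rewrite f'E ne.
  rewrite !hf' f'E eqxx (fixA _ _ _ hf' f'E x) // (fixA _ _ _ hf' f'E y) //.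
  by rewrite !mulgA mulgV mul1g mulgVK.
move=> Ag Ah; have [f [hf fE]] := ex g h; have [f' [hf' f'E]] := ex g^-1 h^-1.
exists f; split; last by rewrite fE eqxx.
- split=> //; exists f'; first exact: (inv g h).
  apply: (inv g^-1 h^-1) => //; rewrite /inA ?instdV //.
  by move=> i; rewrite !invgK.
- exact: fixA hf fE.
Qed.

Section Edges.
Variables (C D : set F).

(** Rotated to start at [y], the cyclic word of an elliptic element that contains [t g t] ends in
    [x], and the rotation is a conjugation. *)
Lemma arc_edge g x y w v : arcset (elliptic C D) g ->
  tl true :: nf g ++ [:: tl true] = w ++ x :: y :: v -> whitehead b C D (linv x) y.
Proof.
move=> [c [L [AL gL El]]] E; set L0 := _ :: _ :: L in AL gL El.
have rW := reduced_sword AL gL.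
have E0 : sword L0 = (tl true :: nf g ++ [:: tl true]) ++ nf c ++ sword L.
  by rewrite /sword /= -catA.
have cW : cyc_reduced (sword L0).
  by move: rW; rewrite E0 /cyc_reduced /=.
move: cW; rewrite -(cyc_reduced_rot (size (rcons w x))).
have E1 : sword L0 = rcons w x ++ y :: v ++ nf c ++ sword L.
  by rewrite E0 E cat_rcons -catA.
rewrite E1 rot_size_cat => cW.
exists ((v ++ nf c ++ sword L) ++ rcons w x); split=> //.
  by rewrite last_cat last_rcons linvK.
rewrite -cat_cons weval_cat; set a := weval (y :: _); set a' := weval (rcons w x).
have -> : a * a' = (a' * a) ^ a' by rewrite conjgE !mulgA mulVg mul1g.
by apply: elliptic_conj; rewrite /a /a' -weval_cat -E1 weval_sword.
Qed.

End Edges.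

End Syllables.

(** * The filling word and its Whitehead graph *)

Section FillingWord.
Variable m : nat.
Hypothesis hm : (1 < m)%N.
Implicit Types (x y d : letter m.+1) (w v p q : seq (letter m.+1)).

Definition aletter (j : nat) : letter m.+1 := (inord j, true).

(* Its Whitehead graph is a Hamiltonian cycle on the letters of [A]. *)
Definition fillw := rcons (flatten [seq [:: aletter j; aletter j] | j <- iota 0 m]) (aletter 0).

Lemma fillw_split i j : (i + j = m)%N -> (0 < j)%N -> exists p q,
  fillw = p ++ aletter i :: aletter i :: (if j is 1 then [:: aletter 0] else aletter i.+1 :: q).
Proof.
move=> ij; case: j ij => // j ij _.
have -> : fillw = flatten [seq [:: aletter k; aletter k] | k <- iota 0 i] ++
    aletter i :: aletter i ::
    rcons (flatten [seq [:: aletter k; aletter k] | k <- iota i.+1 j]) (aletter 0).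
  have E : iota 0 m = iota 0 i ++ i :: iota i.+1 j by rewrite -ij iotaD.
  by rewrite /fillw E map_cat flatten_cat rcons_cat.
exists (flatten [seq [:: aletter k; aletter k] | k <- iota 0 i]).
case: j {ij} => [|j] /=; first by exists [::].
by eexists.
Qed.

Section Connected.
Variables (W : letter m.+1 -> letter m.+1 -> Prop) (v : option (letter m.+1)).
Variable col : letter m.+1 -> bool.
Hypothesis Wsym : forall d d', W d d' -> W d' d.
Hypothesis Wfill : forall x y p q, fillw = p ++ x :: y :: q -> W (linv x) y.
Hypothesis Wcol : forall d d', W d d' -> Some d <> v -> Some d' <> v -> col d = col d'.

(** The vertex at position [k] of the Hamiltonian cycle [a_0], [a_0^-1], [a_1], [a_1^-1], and so
    on. *)
Let cyc k : letter m.+1 := (inord k./2, ~~ odd k).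

Let cyc_step k : (k.+1 < m.*2)%N -> W (cyc k) (cyc k.+1).
Proof.
move=> lt; have [p [q E]] : exists p q, fillw = p ++ aletter k./2 :: aletter k./2 ::
    (if (m - k./2)%N is 1 then [:: aletter 0] else aletter k./2.+1 :: q).
  by apply: fillw_split; lia.
case ok : (odd k).
  have [j Ej] : exists j, (m - k./2)%N = j.+2 by exists (m - k./2).-2; lia.
  rewrite Ej -cat_rcons in E; move/Wfill: E; rewrite /cyc /= ok /=.
  by have -> : uphalf k = k./2.+1 by rewrite uphalf_half ok.
apply: Wsym; move/Wfill: E; rewrite /cyc /= ok /=.
by have -> : uphalf k = k./2 by rewrite uphalf_half ok.
Qed.

Let cyc_last : W (cyc m.*2.-1) (cyc 0).
Proof.
have [|//|p [q E]] := @fillw_split m.-1 1; first by lia.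
rewrite -cat_rcons in E; move/Wfill: E.
have H : m.*2.-1 = (m.-1).*2.+1 by lia.
by rewrite /cyc H /= uphalf_double odd_double.
Qed.

Let cyc_inj k k' : (k < m.*2)%N -> (k' < m.*2)%N -> cyc k = cyc k' -> k = k'.
Proof.
move=> lt lt' [/(congr1 val)]; by rewrite /= !inordK; lia.
Qed.

Let cyc_surj d : d.1 != ord_max -> exists2 k, (k < m.*2)%N & d = cyc k.
Proof.
case: d => i e /= ne; have lt : (i < m)%N.
  by have := ltn_ord i; move: ne; rewrite -val_eqE /=; lia.
exists (~~ e + i.*2)%N; first by case: e; lia.
rewrite /cyc half_bit_double oddD odd_double addbF oddb negbK.
by congr pair; apply: val_inj; rewrite /= inordK //; lia.
Qed.

Let cyc_chain i j : (i + j < m.*2)%N ->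
  (forall k, (i <= k <= i + j)%N -> Some (cyc k) <> v) -> col (cyc i) = col (cyc (i + j)).
Proof.
elim: j => [|j IH] lt H; first by rewrite addn0.
rewrite IH; [|lia|by move=> k le; apply: H; lia].
by rewrite addnS; apply: Wcol; [apply: cyc_step; lia|apply: H; lia|apply: H; lia].
Qed.

(** A cycle without one vertex is still connected: if [v] lies between the two positions, the path
    goes the other way round through [cyc_last]. *)
Lemma fill_connected d d' : d.1 != ord_max -> d'.1 != ord_max ->
  Some d <> v -> Some d' <> v -> col d = col d'.
Proof.
move=> /cyc_surj[i li ->] /cyc_surj[j lj ->].
wlog le : i j li lj / (i <= j)%N.
  by move=> H ni nj; have [/H|/ltnW/H] := leqP i j; [apply|move=> /(_ lj li nj ni)].
move=> ni nj; have [[k0 [/andP[ik kj] vE]]|none] :=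
  pselect (exists k, (i <= k <= j)%N /\ Some (cyc k) = v); last first.
  rewrite -(subnKC le); apply: cyc_chain; first by rewrite subnKC.
  by move=> k; rewrite subnKC // => le' E; apply: none; exists k.
have out k : (k < m.*2)%N -> k <> k0 -> Some (cyc k) <> v.
  move=> lk ne; rewrite -vE => /Some_inj E; apply/ne/cyc_inj => //; lia.
have ik0 : i <> k0 by move=> E; apply: ni; rewrite E.
have jk0 : j <> k0 by move=> E; apply: nj; rewrite E.
have <- : col (cyc 0) = col (cyc i).
  by apply: (@cyc_chain 0 i) => [|k le']; [lia|apply: out; lia].
have -> : col (cyc j) = col (cyc m.*2.-1).
  have -> : m.*2.-1 = (j + (m.*2.-1 - j))%N by lia.
  by apply: cyc_chain => [|k le']; [lia|apply: out; lia].
by apply/esym/Wcol; [exact: cyc_last|apply: out; lia|apply: out; lia].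
Qed.

End Connected.
End FillingWord.

(** * Bounded variation of the counting quasi-morphism on the arcs of a splitting *)

Section ArcSpread.
Variables (F : groupType) (m : nat) (b : 'I_m.+1 -> F) (hb : is_basis b).
Hypothesis hm : (1 < m)%N.
Implicit Types (x y d : letter m.+1) (w v p q : seq (letter m.+1)) (g h c : F).

Local Notation nf := (nf hb).
Local Notation wlen := (wlen hb).
Local Notation weval := (weval b).
Local Notation tl e := ((ord_max, e) : letter m.+1).
Local Notation tpow e := (lval b (tl e)).
Local Notation inA := (inA hb).
Local Notation arcset := (arcset hb).
Local Notation u := (fillw m).

Definition fills g := infix u (nf g) || infix (winv u) (nf g).

Section Position.
Variables (C D : set F).
Hypotheses (fCD : free_product2 C D) (nC : nontrivial C) (nD : nontrivial D).
Local Notation arcs := (arcset (elliptic C D)).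
Local Notation W := (whitehead b C D).

Let Wsym d d' : W d d' -> W d' d.
Proof. exact: (whitehead_sym fCD). Qed.

Let arcs_fill g : arcs g -> fills g ->
  forall x y p q, u = p ++ x :: y :: q -> W (linv x) y.
Proof.
move=> ag fg x y p q uE; case/orP: fg => /infixP[w [v E]].
  apply: (arc_edge (w := tl true :: w ++ p) (v := q ++ v ++ [:: tl true]) ag).
  by rewrite E uE /= -!catA.
apply: Wsym; rewrite -[y in W y _]linvK.
apply: (arc_edge (w := tl true :: w ++ winv q) (v := winv p ++ v ++ [:: tl true]) ag).
rewrite E uE winv_cat /= -!catA; congr (_ :: w ++ _).
by rewrite !winv_cons -!cats1 -!catA.
Qed.

Let arc_out x w g : arcs g -> nf g = x :: w -> W (tl false) x.
Proof.
move=> ag E; have := arc_edge (w := [::]) (x := tl true) (y := x) (v := w ++ [:: tl true]) ag.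
by apply; rewrite E.
Qed.

Let arc_in x w g : arcs g -> nf g = rcons w x -> W (linv x) (tl true).
Proof.
move=> ag E; apply: (arc_edge (w := tl true :: w) (v := [::]) ag).
by rewrite E cat_rcons.
Qed.

(** A filling arc connects the letters of [A], whichever vertex is removed. If [t] and its inverse
    were always attached to a remaining letter of [A], the whole graph would violate
    [cut_vertex]. *)
Lemma anchored g : arcs g -> fills g ->
  ~ forall (v : option (letter m.+1)) (col : letter m.+1 -> bool),
    (forall d d', W d d' -> Some d <> v -> Some d' <> v -> col d = col d') ->
    forall e, Some (tl e) <> v ->
    exists d, [/\ d.1 != ord_max, Some d <> v & col (tl e) = col d].
Proof.
move=> ag fg anch; apply: (cut_vertex hb fCD nC nD) => v col H.
have {}anch d : Some d <> v -> exists d', [/\ d'.1 != ord_max, Some d' <> v & col d = col d'].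
  have [dmax|] := eqVneq d.1 ord_max; last by exists d.
  by case: d dmax => i e /= -> ne; apply: anch.
move=> d d' /anch[x [xm xv ->]] /anch[y [ym yv ->]].
exact: (fill_connected hm Wsym (arcs_fill ag fg) H).
Qed.

Lemma arcset_inA Ell g : arcset Ell g -> inA g.
Proof. by move=> [c [L [/and3P[]]]]. Qed.

Let head_inA g x w : inA g -> nf g = x :: w -> x.1 != ord_max.
Proof. by rewrite /inA /instd => + E; rewrite E => /andP[]. Qed.

Let last_inA g x w : inA g -> nf g = rcons w x -> (linv x).1 != ord_max.
Proof. by rewrite /inA /instd => + E; rewrite E all_rcons => /andP[]. Qed.

(** Both [t] and its inverse have two distinct neighbours in [A], and the removal of a vertex leaves
    each of them one. *)
Lemma diverging_arcs g h x1 w1 l1 v1 x2 w2 l2 v2 : arcs g -> arcs h -> fills g ->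
  nf g = x1 :: w1 -> nf g = rcons v1 l1 -> nf h = x2 :: w2 -> nf h = rcons v2 l2 ->
  x1 <> x2 -> l1 <> l2 -> False.
Proof.
move=> ag ah fg g1 g2 h1 h2 nx nl; apply: (anchored ag fg) => v col H.
have Ag := arcset_inA ag; have Ah := arcset_inA ah.
have Wf := Wsym (arc_in ag g2); have Wf' := Wsym (arc_in ah h2).
case=> ne; first have [E|nv] := pselect (Some (linv l1) = v).
- exists (linv l2); have n2 : Some (linv l2) <> v.
    by rewrite -E => /Some_inj/linv_inj/esym.
  by split; [exact: last_inA h2|exact: n2|exact: H].
- by exists (linv l1); split; [exact: last_inA g2|exact: nv|exact: H].
have [E|nv] := pselect (Some x1 = v).
- exists x2; have n2 : Some x2 <> v by rewrite -E => /Some_inj/esym.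
  by split; [exact: head_inA h1|exact: n2|apply: H => //; exact: arc_out h1].
- by exists x1; split; [exact: head_inA g1|exact: nv|apply: H => //; exact: arc_out g1].
Qed.

(** The arc [1] joins [t] to its inverse. When the neighbour in [A] of one of them is removed, the
    other one leads to its own neighbour, which is different because [x <> linv l]. *)
Lemma trivial_arc g x w l v : arcs g -> arcs 1 -> fills g ->
  nf g = x :: w -> nf g = rcons v l -> x <> linv l -> False.
Proof.
move=> ag a1 fg g1 g2 nx; apply: (anchored ag fg) => v' col H.
have Ag := arcset_inA ag.
have Wx := arc_out ag g1; have Wl := Wsym (arc_in ag g2).
have Wt : W (tl false) (tl true).
  by apply: (arc_edge (w := [::]) (x := tl true) (y := tl true) (v := [::]) a1); rewrite nf1.
have lm := last_inA Ag g2; have xm := head_inA Ag g1.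
case=> ne.
- have [E|nv] := pselect (Some (linv l) = v'); last by exists (linv l); split=> //; exact: H.
  have n2 : Some x <> v' by rewrite -E => /Some_inj.
  exists x; split=> //; have nf' : Some (tl false) <> v'.
    by rewrite -E => /Some_inj E'; move: lm; rewrite -E' eqxx.
  by rewrite (H _ _ (Wsym Wt)) // (H _ _ Wx).
- have [E|nv] := pselect (Some x = v'); last by exists x; split=> //; exact: H.
  have n2 : Some (linv l) <> v' by rewrite -E => /Some_inj/esym.
  exists (linv l); split=> //; have nt : Some (tl true) <> v'.
    by rewrite -E => /Some_inj E'; move: xm; rewrite -E' eqxx.
  by rewrite (H _ _ Wt) // (H _ _ Wl).
Qed.

End Position.

Lemma fillw_nonempty : u != [::].
Proof. by rewrite /fillw; case: (flatten _). Qed.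

Lemma fills_nonempty g : fills g -> nf g != [::].
Proof.
by rewrite /fills; case: (nf g) => //; rewrite !infixs0 -!size_eq0 size_winv orbb size_eq0
   (negbTE fillw_nonempty).
Qed.

Let wlen_head g x w : nf g = x :: w -> wlen g = (wlen ((lval b x)^-1 * g)).+1.
Proof.
move=> E; have := nf_reduced hb g; rewrite E => /path_sorted rw.
have gE : g = lval b x * weval w by rewrite -[LHS](nfK hb) E.
by rewrite [in RHS]gE mulKg /wlen E wevalK.
Qed.

Let wlen_last g x w : nf g = rcons w x -> wlen g = (wlen (g * (lval b x)^-1)).+1.
Proof.
move=> E; have := nf_reduced hb g; rewrite E -cats1 => /reduced_catl rw.
have gE : g = weval w * lval b x by rewrite -[LHS](nfK hb) E weval_rcons.
by rewrite [in RHS]gE mulgK /wlen E size_rcons wevalK.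
Qed.

(** Induction on the total length. While one arc fills, [diverging_arcs] and [trivial_arc] leave
    three cases: a common first letter, a common last letter, or a trivial arc next to one that
    begins and ends with inverse letters. In each case a twist shortens the total. *)
Lemma arcs_reduce C D g h : free_product2 C D -> nontrivial C -> nontrivial D ->
  arcset (elliptic C D) g -> arcset (elliptic C D) h ->
  exists x y : F, [/\ inA x, inA y, ~~ fills (y * g * x) & ~~ fills (y * h * x)].
Proof.
have [N le] := ubnP (wlen g + wlen h); elim: N C D g h le => // N IH C D g h.
rewrite ltnS => le fCD nC nD.
have [fgh|] := boolP (fills g || fills h); last first.
  rewrite negb_or => /andP[fg fh] _ _; exists 1, 1.
  by rewrite !mul1g !mulg1 /inA !instd1.
wlog fg : g h le {fgh} / fills g.
  move=> H; case/orP: fgh => f ag ah; first exact: (H g h).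
  by have [|x [y []]] := H h g _ f ah ag; [rewrite addnC|exists x, y].
move=> ag ah; have Ag := arcset_inA ag; have Ah := arcset_inA ah.
(* The twist turns the arcs of [C * D] into arcs of the image splitting, to which the induction
   hypothesis applies; the two substitutions then compose. *)
have step (x y : F) : inA x -> inA y -> (wlen (y * g * x) + wlen (y * h * x) < wlen g + wlen h)%N ->
    exists x y : F, [/\ inA x, inA y, ~~ fills (y * g * x) & ~~ fills (y * h * x)].
  move=> Ax Ay lt; have [theta [autt fixA ttE]] := twist_aut Ax Ay.
  have ell k : elliptic C D k -> elliptic (theta @` C) (theta @` D) (theta k).
    move=> [p Hp]; exists (theta p); rewrite -[_ ^ _]/((theta p)^-1 * (theta k * theta p)).
    rewrite -(homV _ autt.1) -!autt.1 -conjgE.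
    by case: Hp => Hp; [left|right]; exists (k ^ p).
  have tw := arcset_twist Ax Ay autt.1 fixA ttE ell (@elliptic_conj _ _ _).
  have [||||||x' [y' [Ax' Ay' Hg Hh]]] := IH (theta @` C) (theta @` D) (y * g * x) (y * h * x).
  - exact: leq_trans lt le.
  - exact: free_product2_image.
  - exact: nontrivial_image.
  - exact: nontrivial_image.
  - exact: tw.
  - exact: tw.
  by exists (x * x'), (y' * y); split; rewrite ?mulgA -?mulgA; [exact: instdM|exact: instdM| |];
     rewrite !mulgA in Hg Hh *.
have lvA x : x.1 != ord_max -> inA (lval b x) by move=> ne; rewrite /inA instd_lval.
have lvA' x : x.1 != ord_max -> inA (lval b x)^-1 by move=> ne; rewrite /inA instdV; exact: lvA.
have A1 : inA 1 by exact: instd1.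
have := fills_nonempty fg; case Eg : (nf g) => [//|x w] _.
have [v [l El]] : exists v l, x :: w = rcons v l by rewrite lastI; eexists; eexists.
have Eg' : nf g = rcons v l by rewrite Eg.
have xm : x.1 != ord_max by move: Ag; rewrite /inA /instd Eg => /andP[].
have lm : l.1 != ord_max by move: Ag; rewrite /inA /instd Eg' all_rcons => /andP[].
case Eh : (nf h) => [|x' w'].
  have h1 : h = 1 by apply: (@wlen_eq0 _ _ _ hb); rewrite /wlen Eh.
  have [xl|/eqP nxl] := eqVneq x (linv l); last first.
    by rewrite h1 in ah; case: (trivial_arc fCD nC nD ag ah fg Eg Eg' nxl).
  (* Conjugation removes both ends of [g] and keeps the trivial arc trivial. *)
  apply: (step (lval b x) (lval b x)^-1); [exact: lvA|exact: lvA'|].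
  rewrite h1 mulg1 mulVg (wlen_head Eg); set g' := _ * g.
  have [v0 Ez] : exists v0, nf g' = rcons v0 l.
    have : reduced w by move: (nf_reduced hb g); rewrite Eg => /path_sorted.
    move/(wevalK hb); have -> : weval w = g'.
      by rewrite /g' -[g](nfK hb) Eg /= mulKg.
    move=> ->; case: v El {Eg'} => [[xE _]|z v] /=.
      by move: xl; rewrite xE => /esym/eqP; rewrite (negbTE (linv_neq _)).
    by move=> [_ ->]; exists v.
  by have := wlen_last Ez; rewrite xl lvalV => ->; rewrite wlen1; len_lia.
have [v' [l' El']] : exists v l, x' :: w' = rcons v l by rewrite lastI; eexists; eexists.
have Eh' : nf h = rcons v' l' by rewrite Eh.
have [xx|/eqP nx] := eqVneq x x'.
  apply: (step 1 (lval b x)^-1); [by []|exact: lvA'|].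
  by rewrite !mulg1 (wlen_head Eg) (wlen_head Eh) -xx; len_lia.
have [ll|/eqP nl] := eqVneq l l'.
  apply: (step (lval b l)^-1 1); [exact: lvA'|by []|].
  by rewrite !mul1g (wlen_last Eg') (wlen_last Eh') -ll; len_lia.
by case: (diverging_arcs fCD nC nD ag ah fg Eg Eg' Eh Eh' nx nl).
Qed.

Local Notation hq := (hq u hb).

(** [hq] vanishes on [y * g * x] and [y * h * x]. Expanding both takes four uses of [hq_mul], with
    error [3 * size u] each, and the values at [x] and [y] drop out of the difference. *)
Lemma arc_spread C D g h : free_product2 C D -> nontrivial C -> nontrivial D ->
  arcset (elliptic C D) g -> arcset (elliptic C D) h ->
  (absz (hq g - hq h)%R <= 12 * size u)%N.
Proof.
move=> fCD nC nD ag ah; have [x [y [_ _]]] := arcs_reduce fCD nC nD ag ah.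
rewrite !negb_or => /andP[g1 g2] /andP[h1 h2].
have := hq_eq0 fillw_nonempty g1 g2; have := hq_eq0 fillw_nonempty h1 h2.
have := hq_mul fillw_nonempty hb (y * g) x; have := hq_mul fillw_nonempty hb (y * h) x.
have := hq_mul fillw_nonempty hb y g; have := hq_mul fillw_nonempty hb y h.
move: (hq (y * g * x)) (hq (y * h * x)) (hq (y * g)) (hq (y * h)) (hq g) (hq h) (hq x) (hq y).
by move: (size u) => k *; lia.
Qed.

End ArcSpread.

(** * Existence of arcs through the exponent sum in [t] *)

Section ArcExistence.
Variables (F : groupType) (m : nat) (b : 'I_m.+1 -> F) (hb : is_basis b).
Implicit Types (g h c p : F) (s : bool * F) (L : seq (bool * F)) (e : bool).

Local Notation nf := (nf hb).
Local Notation tl e := ((ord_max, e) : letter m.+1).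
Local Notation tpow e := (lval b (tl e)).
Local Notation inA := (inA hb).
Local Notation arcset := (arcset hb).
Local Notation sprod := (sprod b).
Local Notation arcs_in := (arcs_in hb).

(** The exponent sum in [t] is the displacement of [0] when [t] acts on [int] by this shift and [A]
    acts trivially. *)
Definition shift : sym int.
Proof.
by exists (fun z => z + 1)%R (fun z => z - 1)%R => z; rewrite ?GRing.addrK ?GRing.subrK.
Defined.

Lemma exponent_exists : exists ex : F -> int,
  [/\ forall g h, ex (g * h) = (ex g + ex h)%R, ex (tpow true) = 1%R
    & forall g, inA g -> ex g = 0%R].
Proof.
have [f [hf fE]] := basis_ext hb (fun i : 'I_m.+1 => if i == ord_max then shift else 1).
have fz g z : f g z = (z + f g 0)%R.
  pose K : set F := [set g | forall z, f g z = (z + f g 0)%R].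
  apply: (@basis_full _ _ _ hb K) => [|i {}z]; last first.
    by rewrite fE; case: eqP => _ /=; lia.
  split=> [{}z|x y Kx Ky {}z]; first by rewrite (hom1 hf) /=; lia.
  have KV w : f y^-1 w = (w - f y 0)%R.
    have : f y (f y^-1 w) = w by rewrite -symM -hf mulgV (hom1 hf).
    by rewrite Ky; lia.
  by rewrite !hf !symM Kx [in RHS]Kx !KV; lia.
have exM g h : f (g * h)%g 0%R = (f g 0 + f h 0)%R by rewrite hf symM fz; lia.
exists (fun g => f g 0%R); split=> //; first by rewrite fE eqxx /=; lia.
move=> g; rewrite /inA /instd -[in f g](nfK hb g); elim: (nf g) => [|x w IH] /=.
  by rewrite (hom1 hf).
move=> /andP[/negbTE xm /IH E]; rewrite exM E.
suff -> : f (lval b x) = 1 by [].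
by rewrite /lval; case: (x.2); rewrite ?homV // fE xm ?invg1.
Qed.

Definition sgnsum L : int :=
  ((count (fun s => s.1) L)%:Z - (count (fun s => ~~ s.1) L)%:Z)%R.

Lemma sgnsum_cat L L' : sgnsum (L ++ L') = (sgnsum L + sgnsum L')%R.
Proof. by rewrite /sgnsum !count_cat; lia. Qed.

Lemma sgnsum_cons s L : sgnsum (s :: L) = ((if s.1 then 1 else -1) + sgnsum L)%R.
Proof. by rewrite /sgnsum /=; case: (s.1) => /=; lia. Qed.

Lemma exponent_sprod (ex : F -> int) L :
  (forall g h, ex (g * h) = (ex g + ex h)%R) -> ex (tpow true) = 1%R ->
  (forall g, inA g -> ex g = 0%R) -> arcs_in L -> ex (sprod L) = sgnsum L.
Proof.
move=> exM ext exA; have ex1 : ex 1 = 0%R by apply: exA; exact: instd1.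
have extf : ex (tpow false) = (-1)%R.
  have := exM (tpow true) (tpow false); rewrite ext.
  by rewrite (lvalV b (tl true)) mulgV ex1; lia.
elim: L => [|s L IH] //= /andP[/exA sA /IH E].
by rewrite !exM sA E sgnsum_cons; case: s.1; rewrite ?ext ?extf; lia.
Qed.

Lemma syllables_exist g : exists c L, [/\ inA c, arcs_in L & g = c * sprod L].
Proof.
elim/(nf_ind hb): g => [|x g [c [L [Ac AL ->]]]].
  by exists 1, [::]; rewrite mulg1; split=> //; exact: instd1.
have [xm|xm] := eqVneq x.1 ord_max.
  exists 1, ((x.2, c) :: L); split; first exact: instd1.
    by rewrite /arcs_in /= Ac.
  by rewrite mul1g /= -{1}xm; case: x xm.
exists (lval b x * c), L; split=> //; last by rewrite mulgA.
by apply: instdM => //; rewrite instd_lval.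
Qed.

Lemma sprod_rcons_arc L s g : sprod (rcons L (s.1, s.2 * g)) = sprod (rcons L s) * g.
Proof. by rewrite -!cats1 !sprod_cat /= !mulg1 !mulgA. Qed.

Lemma bad_syllable L e : ~~ good L e -> exists L1 s L2,
  [/\ L = L1 ++ s :: L2, s.2 = 1 & s.1 = ~~ nxt L2 e].
Proof.
elim: L => //= s L IH; rewrite negb_and => /orP[|/IH[L1 [s' [L2 [-> H1 H2]]]]].
  rewrite negb_or negbK => /andP[ne /eqP s1]; exists [::], s, L; split=> //.
  by case: (s.1) ne; case: nxt.
by exists (s :: L1), s', L2.
Qed.

(** A violation of [good] is rotated to the front, where [t] and its inverse cancel, and the
    leftover arc is merged into the last one. *)
Lemma cyclic_syllables L : arcs_in L -> sgnsum L <> 0%R -> exists L' p,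
  [/\ arcs_in L', good L' (nxt L' true), sgnsum L' = sgnsum L & sprod L' = sprod L ^ p].
Proof.
have [N le] := ubnP (size L); elim: N L le => // N IH L; rewrite ltnS => le AL n0.
have [gL|] := boolP (good L (nxt L true)).
  by exists L, 1; rewrite conjg1.
case/bad_syllable=> L1 [s [L2 [LE s1 sn]]].
have {}sn : s.1 = ~~ nxt (L2 ++ L1) s.1.
  by rewrite nxt_cat [LHS]sn LE nxt_cat.
have P1 : sprod (s :: L2 ++ L1) = sprod L ^ sprod L1.
  rewrite LE sprod_cat conjgE (sprod_cat b (s :: L2) L1).
  by move: (sprod (s :: L2)) (sprod L1) => g1 g2; rewrite !mulgA mulVg mul1g.
have S1 : sgnsum (s :: L2 ++ L1) = sgnsum L.
  by rewrite LE -cat_cons !sgnsum_cat; lia.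
have A1 : arcs_in (s :: L2 ++ L1).
  by move: AL; rewrite LE /arcs_in -cat_cons !all_cat andbC.
have size1 : size (s :: L2 ++ L1) = size L by rewrite LE /= !size_cat /=; lia.
(* A single syllable is not opposite to itself, and two opposite ones have sign sum zero; so a third
   syllable is there to absorb the arc. *)
case: (L2 ++ L1) sn P1 S1 A1 size1 => [|s' L3] sn P1 S1 A1 size1.
  by case: (s.1) sn.
rewrite /= in sn.
case/lastP: L3 P1 S1 A1 size1 => [|L3 s''] P1 S1 A1 size1.
  case: n0; rewrite -S1 !sgnsum_cons /sgnsum /= sn.
  by case: (s'.1) => /=; lia.
have P2 : sprod (rcons L3 (s''.1, s''.2 * s'.2)) = sprod L ^ (sprod L1 * s'.2).
  rewrite conjgM -P1 sprod_rcons_arc /= s1 mul1g.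
  have -> : tpow s.1 = (tpow s'.1)^-1 by rewrite sn -lvalV.
  by rewrite mulKg conjgE !mulgA mulVg mul1g.
have S2 : sgnsum (rcons L3 (s''.1, s''.2 * s'.2)) = sgnsum L.
  rewrite -S1 !sgnsum_cons -!cats1 !sgnsum_cat sn.
  by rewrite /sgnsum /=; case: (s'.1) => /=; lia.
have A2 : arcs_in (rcons L3 (s''.1, s''.2 * s'.2)).
  move: A1; rewrite /arcs_in /= !all_rcons /= => /and4P[_ A' A'' ->].
  by rewrite andbT; apply: instdM.
have [|//||L' [p [A3 g3 S3 P3]]] := IH (rcons L3 (s''.1, s''.2 * s'.2)).
- by move: le; rewrite -size1 /= !size_rcons; lia.
- by rewrite S2.
exists L', (sprod L1 * s'.2 * p); split=> //; first by rewrite S3.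
by rewrite P3 P2 !conjgM.
Qed.

Definition not_both s s' := ~~ (s.1 && s'.1).

(** Isolated positive signs are separated by negative ones, and negative signs at the ends are
    surplus. *)
Lemma not_both_count s L : path not_both s L ->
  (count (fun s => s.1) (s :: L) + ~~ s.1 + ~~ (last s L).1 <=
   count (fun s => ~~ s.1) (s :: L) + 1)%N.
Proof.
elim: L s => [|s' L IH] s /=; first by case: (s.1) => _ /=; lia.
move=> /andP[n /IH]; move: n; rewrite /not_both /=.
by case: (s.1); case: (s'.1) => //=; lia.
Qed.

Lemma path_violation (T : Type) (r : rel T) x (w : seq T) : ~~ path r x w ->
  exists w1 y z w2, x :: w = w1 ++ y :: z :: w2 /\ ~~ r y z.
Proof.
elim: w x => //= y w IH x; rewrite negb_and => /orP[H|/IH[p [z [z' [q [E H]]]]]].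
  by exists [::], x, y, w.
by exists (x :: p), z, z', q; rewrite E.
Qed.

(** A positive exponent sum forces two cyclically adjacent positive signs in the cyclic normal
    form. *)
Lemma arcset_exists (Ell : F -> Prop) (ex : F -> int) g :
  (forall h p, Ell h -> Ell (h ^ p)) -> (forall h, Ell h -> Ell (h * h)) ->
  (forall g h, ex (g * h) = (ex g + ex h)%R) -> ex (tpow true) = 1%R ->
  (forall g, inA g -> ex g = 0%R) ->
  Ell g -> (0 < ex g)%R -> exists c, arcset Ell c.
Proof.
move=> EC EX exM ext exA Eg pos.
have exV h : ex h^-1 = (- ex h)%R.
  by have := exM h h^-1; rewrite mulgV exA; [lia|exact: instd1].
have [c [L [AL gE]]] : exists c L, arcs_in L /\ sprod L = g ^ c.
  have [c [L [Ac AL gE]]] := syllables_exist g.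
  case/lastP: L AL gE => [|L s] AL gE; first
    by move: pos; rewrite gE exM (exA _ Ac) (exA (sprod [::]) (instd1 hb _)).
  exists c, (rcons L (s.1, s.2 * c)); split; last first.
    by rewrite sprod_rcons_arc conjgE gE !mulgA mulVg mul1g.
  move: AL; rewrite /arcs_in !all_rcons => /andP[sA ->]; rewrite andbT.
  exact: instdM.
have Lpos : (0 < sgnsum L)%R.
  by rewrite -(exponent_sprod exM ext exA AL) gE conjgE !exM exV; lia.
have [|L' [p [A' g' S' P']]] := cyclic_syllables AL; first by lia.
(* The square leaves room for two adjacent positive signs even if they wrap around or come from a
   single syllable. *)
have ell : forall q, Ell (sprod (L' ++ L') ^ q).
  by move=> q; apply: (EC); rewrite sprod_cat P' gE; apply: EX; apply/EC/EC.
case: L' A' g' S' P' ell => [|s L'] A' g' S' P' ell; first by move: Lpos; rewrite -S' /sgnsum /=; lia.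
have viol : ~~ path not_both s (rcons L' s).
  rewrite rcons_path; apply/negP => /andP[/not_both_count H1 H2].
  move: Lpos; rewrite -S' /sgnsum; move: H1 H2; rewrite /not_both.
  move: (count _ _) (count _ _) => k k'.
  by case: (s.1); case: ((last s L').1) => //=; lia.
have [p1 [s1 [s2 [q1 [E]]]]] := path_violation viol.
rewrite /not_both negbK => /andP[t1 t2].
case: s1 t1 E => /= e1 c1; move: e1 => [] // _; case: s2 t2 => /= e2 c2; move: e2 => [] // _ E.
have E2 : (s :: L') ++ (s :: L') = p1 ++ (true, c1) :: (true, c2) :: (q1 ++ L').
  by rewrite -[in RHS]cat_cons -[in RHS]cat_cons catA -E /= cat_rcons.
exists c1, c2, ((q1 ++ L') ++ p1).
set R := _ :: _ :: q1 ++ L' in E2; rewrite -[_ :: _ :: _]/(R ++ p1).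
have gg : good (p1 ++ R) s.1 by rewrite -E2 good_cat /= in g' *; rewrite /= g'.
have AA : arcs_in (p1 ++ R) by rewrite -E2 /arcs_in all_cat /= in A' *; rewrite A'.
split.
- by move: AA; rewrite /arcs_in !all_cat andbC.
- move: gg; rewrite 2!good_cat => /andP[gp gR]; apply/andP; split.
    suff -> : nxt p1 true = s.1 by [].
    have := congr1 (fun L => nxt L true) E2; rewrite /= nxt_cat /=.
    by move=> ->.
  exact: gp.
- have -> : sprod (R ++ p1) = sprod (p1 ++ R) ^ sprod p1.
    rewrite conjgE !sprod_cat; move: (sprod R) (sprod p1) => g1 g2.
    by rewrite !mulgA mulVg mul1g.
  by rewrite -E2; exact: ell.
Qed.

End ArcExistence.

(** * Orbits in the edge splitting graph *)

Section EdgeSplittingOrbits.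
Variables (F : groupType) (m : nat) (b : 'I_m.+1 -> F) (hb : is_basis b).
Hypothesis hm : (1 < m)%N.
Implicit Types (g h p : F) (A B : set F) (c : ES F).

Local Notation nf := (nf hb).
Local Notation weval := (weval b).
Local Notation tpow e := (lval b ((ord_max, e) : letter m.+1)).
Local Notation inA := (inA hb).
Local Notation arcset := (arcset hb).
Local Notation u := (fillw m).
Local Notation hq := (hq u hb).

(** The representative may be conjugated and its factors exchanged, so this is ellipticity with
    respect to the splitting. *)
Definition es_elliptic c g := exists A B, sval c [set A; B] /\ A g.

Lemma es_ellipticE c A B : sval c = es_class A B -> es_elliptic c = elliptic A B.
Proof.
move=> cE; apply/funext => g; apply/propext; split.
  move=> [A' [B' []]]; rewrite cE => -[p E].
  by have [[-> _]|[-> _]] := set2_inj E => /conjsE Hg; exists p^-1; [left|right].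
move=> [p [Hg|Hg]]; [exists (conjs p^-1 A), (conjs p^-1 B)|exists (conjs p^-1 B), (conjs p^-1 A)].
  by split; [rewrite cE; exists p^-1|apply/conjsE; rewrite invgK].
by split; [rewrite cE; exists p^-1; rewrite setUC|apply/conjsE; rewrite invgK].
Qed.

Lemma es_elliptic_closed c : [/\ forall g p, es_elliptic c g -> es_elliptic c (g ^ p),
  forall g, es_elliptic c g -> es_elliptic c (g * g)
  & forall g, es_elliptic c g -> es_elliptic c g^-1].
Proof.
have [A [B [fAB _ _ cE]]] := svalP c; rewrite (es_ellipticE cE); split=> [g p|g|g].
- exact: elliptic_conj.
- by rewrite -expg2; apply: (ellipticX fAB).
- exact: (ellipticV fAB).
Qed.

Lemma es_arc_spread c g h : arcset (es_elliptic c) g -> arcset (es_elliptic c) h ->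
  (absz (hq g - hq h)%R <= 12 * size u)%N.
Proof.
have [A [B [fAB nA nB cE]]] := svalP c; rewrite (es_ellipticE cE).
exact: (arc_spread hm fAB nA nB).
Qed.

(** The factors generate, so the exponent sum in [t] cannot vanish on all of them; after an
    inversion it is positive. *)
Lemma free_product_arc (I : finType) (P : I -> set F) (Ell : F -> Prop) :
  free_product P -> (forall i g, P i g -> Ell g) ->
  (forall g p, Ell g -> Ell (g ^ p)) -> (forall g, Ell g -> Ell (g * g)) ->
  (forall g, Ell g -> Ell g^-1) -> exists g, arcset Ell g.
Proof.
move=> fP PE EC EX EV; have [ex [exM ext exA]] := exponent_exists hb.
have ex1 : ex 1 = 0%R by rewrite exA //; exact: instd1.
have exV g : ex g^-1 = (- ex g)%R by have := exM g g^-1; rewrite mulgV ex1; lia.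
have [i [g [Pg ne]]] : exists i g, P i g /\ ex g <> 0%R.
  apply: contrapT => no; have := free_product_full (K := [set g | ex g = 0%R]) fP.
  move=> /(_ _ _ (tpow true)); rewrite /= ext => H; suff : (1%R : int) = 0%R by [].
  apply: H => [|i g Pg /=]; last by apply: contrapT => ne; apply: no; exists i, g.
  by split=> //= x y x0 y0; rewrite exM exV x0 y0.
have [pos|neg] : (0 < ex g)%R \/ (0 < ex (g^-1)%g)%R by rewrite exV; lia.
  exact: (arcset_exists EC EX exM ext exA (PE _ _ Pg) pos).
exact: (arcset_exists EC EX exM ext exA (EV _ (PE _ _ Pg)) neg).
Qed.

Lemma es_arc_exists c : exists g, arcset (es_elliptic c) g.
Proof.
have [A [B [fAB _ _ cE]]] := svalP c; have [H1 H2 H3] := es_elliptic_closed c.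
apply: (free_product_arc fAB) => // i g Pg; rewrite (es_ellipticE cE).
by exists 1; rewrite conjg1; case: i Pg; [left|right].
Qed.

(** The three factors of the common refinement are elliptic in both splittings, and one of them
    provides the arc. *)
Lemma es_adj_arc c c' : es_adj c c' ->
  exists g, arcset (es_elliptic c) g /\ arcset (es_elliptic c') g.
Proof.
move=> [_ [A [B [A' [B' [P [cAB cAB' [fP _] PAB PAB']]]]]]].
have [H1 H2 H3] := es_elliptic_closed c; have [H1' H2' H3'] := es_elliptic_closed c'.
have ell d X Y i g : sval d [set X; Y] -> coarsens P X Y -> P i g -> es_elliptic d g.
  move=> dXY [s [XE YE]] Pg; have [si|nsi] := boolP (s i).
    by exists X, Y; split=> //; rewrite XE => K _; apply; exists i.
  by exists Y, X; rewrite setUC; split=> //; rewrite YE => K _; apply; exists i.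
have [||||g [h [L [A0 g0 [E E']]]]] :=
    @free_product_arc _ P (fun g => es_elliptic c g /\ es_elliptic c' g) fP.
- by move=> i g Pg; split; [exact: (ell c A B i)|exact: (ell c' A' B' i)].
- by move=> g p []; auto.
- by move=> g []; auto.
- by move=> g []; auto.
by exists g; split; exists h, L.
Qed.

Lemma walk_arc_spread c c' k g h : walk (@es_adj F) c c' k ->
  arcset (es_elliptic c) g -> arcset (es_elliptic c') h ->
  (absz (hq g - hq h)%R <= 12 * size u * k.+1)%N.
Proof.
move=> [q [<- <- adj]] ag; elim: k h adj => [|k IH] h adj ah.
  by rewrite muln1; exact: es_arc_spread ag ah.
have [g' [a1 a2]] := es_adj_arc (adj k (ltnSn k)).
have := IH g' (fun i lt => adj i (ltnW lt)) a1; have := es_arc_spread a2 ah.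
rewrite (mulnS _ k.+1); move: (12 * size u)%N (hq g) (hq g') (hq h) => K x y z.
by move: (K * k.+1)%N => N; lia.
Qed.

Lemma es_elliptic_act (o : Out F) phi c g : sval o = out_class phi ->
  es_elliptic c g -> es_elliptic (es_act o c) (phi g).
Proof.
move=> oE [A [B [cAB Ag]]]; exists (phi @` A), (phi @` B); split; last by exists g.
exists phi, [set A; B]; split=> //; last by rewrite image_setU !image_set1.
by rewrite oE; exists 1; apply/funext => x; rewrite conjg1.
Qed.

(** The final letter of the filling word is left out because the next block supplies it; thus [u]
    occurs at the start of every block but the last. *)
Definition fillpow N : seq (letter m.+1) :=
  flatten (nseq N (flatten [seq [:: aletter m j; aletter m j] | j <- iota 0 m])).

Let positive w : all (fun x : letter m.+1 => x.2 && (x.1 != ord_max)) w ->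
  [/\ reduced w, inA (weval w) & occ (winv u) w = 0%N].
Proof.
move=> pw; have rw : reduced w.
  elim: w pw => //= x w IH /andP[/andP[xt _] pw]; have := IH pw.
  case: w pw {IH} => //= y w /andP[/andP[yt _] _] ->; rewrite andbT.
  by apply/eqP => E; move: yt; rewrite E /= xt.
split=> //.
  rewrite /inA /instd wevalK //.
  by apply: sub_all pw => x /andP[].
apply/eqP; rewrite -leqn0 leqNgt; apply/negP => /occ_infix/mem_infix sub.
have := sub (linv (aletter m 0)); rewrite /fillw winv_rcons mem_head => /(_ isT).
by move=> /(allP pw).
Qed.

Let fillpow_positive N : all (fun x : letter m.+1 => x.2 && (x.1 != ord_max)) (fillpow N).
Proof.
apply/allP => x /flattenP[w /nseqP[-> _]] /flattenP[w' /mapP[j]].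
rewrite mem_iota add0n => /andP[_ jm] ->; rewrite !inE orbb => /eqP -> /=.
by rewrite -val_eqE /= inordK; lia.
Qed.

Lemma hq_fillpow N : (N%:Z <= hq (weval (fillpow N.+1)))%R.
Proof.
have [rw _ o0] := positive (fillpow_positive N.+1).
rewrite /hq wevalK // /hword o0; suff : (N <= occ u (fillpow N.+1))%N by lia.
elim: N {rw o0} => // N; rewrite [fillpow N.+2]/(_ ++ fillpow N.+1).
set w := flatten (map _ _); have uE : u = rcons w (aletter m 0) by [].
have [w' wE] : exists w', w = aletter m 0 :: w'.
  by rewrite /w; case: (m) hm => // k _; eexists.
have [X XE] : exists X, fillpow N.+1 = aletter m 0 :: X.
  by rewrite /fillpow /= -/w wE; eexists.
have pu : prefix u (w ++ fillpow N.+1).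
  by rewrite uE XE -cat_rcons prefix_prefix.
move=> IH; have := occ_cat_ge u w' (fillpow N.+1).
have -> : occ u (w ++ fillpow N.+1) =
    (prefix u (w ++ fillpow N.+1) + occ u (w' ++ fillpow N.+1))%N by rewrite {1 2}wE.
by move=> H; rewrite pu add1n ltnS; apply: leq_trans IH (leq_trans (leq_addl _ _) H).
Qed.

Lemma es_orbit_unbounded c M : exists h, inA h /\
  forall (theta : F -> F) (o : Out F), is_aut theta -> sval o = out_class theta ->
    (forall g, inA g -> theta g = g) -> theta (tpow true) = tpow true * h ->
  forall k, (k <= M)%N -> ~ walk (@es_adj F) c (es_act o c) k.
Proof.
have [g ag] := es_arc_exists c.
(* The first summand bounds the change of [hq] along a walk of length at most [M], the second is the
   error in [hq (h * g)]. *)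
pose N := (12 * size u * M.+1 + 3 * size u)%N.
have [_ Ah _] := positive (fillpow_positive N.+2).
exists (weval (fillpow N.+2)); split=> // theta o autt oE fixA tE k kM wk.
set h := weval _ in Ah tE.
have tE' : theta (tpow true) = 1 * tpow true * h by rewrite mul1g.
have A1 : inA 1 by exact: instd1.
have [H1 _ _] := es_elliptic_closed (es_act o c).
have ah : arcset (es_elliptic (es_act o c)) (h * g * 1).
  apply: (arcset_twist A1 Ah autt.1 fixA tE' _ H1 ag) => g'.
  exact: es_elliptic_act.
rewrite mulg1 in ah; have := walk_arc_spread wk ag ah.
have := hq_mul (fillw_nonempty m) hb h g; have := hq_fillpow N.+1; rewrite -/h.
have : (12 * size u * k.+1 <= 12 * size u * M.+1)%N by rewrite leq_mul2l ltnS kM orbT.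
rewrite /N; move: (hq h) (hq g) (hq (h * g)) (12 * size u * k.+1)%N (12 * size u * M.+1)%N.
by move: (size u) => s x y z K K'; lia.
Qed.

End EdgeSplittingOrbits.

(** * Coarse geometry *)

Import Order.TTheory GRing.Theory Num.Theory.

Section GraphMetric.
Variables (R : realType) (V : Type) (adj : V -> V -> Prop).
Implicit Types (x y z : V) (k : nat).

(** Bounds on distances in terms of actual walks, without infima in the extended reals. *)
Definition near_by k x y := exists2 j, (j <= k)%N & walk adj x y j.

Lemma gdist_near_by k x y : near_by k x y -> (gdist R adj x y <= (k%:R)%:E)%E.
Proof.
move=> [j le wj]; apply: (@le_trans _ _ (j%:R)%:E); last by rewrite lee_fin ler_nat.
by apply: ereal_inf_lbound; exists j.
Qed.

Lemma near_by_gdist (C : R) (k : nat) x y : (gdist R adj x y <= C%:E)%E ->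
  (C < k%:R)%R -> near_by k x y.
Proof.
move=> le Ck; apply: contrapT => no; have : (k%:R%:E <= gdist R adj x y)%E.
  apply: le_ereal_inf_tmp => _ [j wj <-]; rewrite lee_fin ler_nat leqNgt.
  by apply/negP => lt; apply: no; exists j; first exact: ltnW.
by move=> /le_trans/(_ le); rewrite lee_fin leNgt Ck.
Qed.

Lemma near_by_refl k x : near_by k x x.
Proof. by exists 0%N => //; exists (fun=> x). Qed.

Lemma near_by_adj x y : adj x y -> near_by 1 x y.
Proof.
move=> a; exists 1%N => //; exists (fun i => if i is 0 then x else y); split=> // i.
by rewrite ltnS leqn0 => /eqP ->.
Qed.

Lemma near_by_trans j k x y z : near_by j x y -> near_by k y z -> near_by (j + k) x z.
Proof.
move=> [j' lej [p [p0 p1 pa]]] [k' lek [q [q0 q1 qa]]].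
exists (j' + k')%N; first exact: leq_add.
exists (fun i => if (i <= j')%N then p i else q (i - j')%N); split=> [||i lt].
- by rewrite leq0n.
- case: ifP => [le|_]; last by rewrite addKn.
  have k0 : k' = 0%N by lia.
  by rewrite k0 addn0 p1 -q0 -k0.
case: (ltngtP i j') => [lt1|gt|E].
- exact: pa.
- by rewrite (_ : (i.+1 - j') = (i - j').+1)%N; [apply: qa; lia|lia].
- by rewrite E p1 -q0 subSnn; apply: qa; lia.
Qed.

Hypothesis adj_sym : forall x y, adj x y -> adj y x.

Lemma near_by_sym k x y : near_by k x y -> near_by k y x.
Proof.
move=> [j le [p [p0 p1 pa]]]; exists j => //; exists (fun i => p (j - i)%N).
split=> [||i lt]; rewrite ?subn0 ?subnn //.
by rewrite (_ : (j - i) = (j - i.+1).+1)%N; [apply/adj_sym/pa; lia|lia].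
Qed.

End GraphMetric.

Lemma near_by_map (V V' : Type) (adj : V -> V -> Prop) (adj' : V' -> V' -> Prop)
    (f : V -> V') k x y :
  (forall x y, adj x y -> f x = f y \/ adj' (f x) (f y)) ->
  near_by adj k x y -> near_by adj' k (f x) (f y).
Proof.
move=> fa [j le [p [<- <- pa]]].
suff : near_by adj' j (f (p 0%N)) (f (p j)).
  by move=> [i lei w]; exists i => //; exact: leq_trans le.
elim: j {le} pa => [|j IH] pa; first exact: near_by_refl.
have [|i lei w] := IH; first by move=> i lt; apply: pa; exact: ltnW.
have near1 : near_by adj' 1 (f (p j)) (f (p j.+1)).
  case: (fa _ _ (pa j (ltnSn j))) => [->|]; first exact: near_by_refl.
  exact: near_by_adj.
have near0 : near_by adj' j (f (p 0%N)) (f (p j)) by exists i.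
by have := near_by_trans near0 near1; rewrite addn1.
Qed.

Lemma sval_inj (T : Type) (P : T -> Prop) : injective (@sval T P).
Proof. by move=> x y; apply: eq_sig_hprop => z p q; exact: Prop_irrelevance. Qed.

(* The orbit to be studied starts at a point whose image is close to the fixed vertex,
   so that no connectedness of the graphs is needed. *)
Section Obstruction.
Variables (R : realType) (F : groupType) (m : nat) (b : 'I_m.+1 -> F) (hb : is_basis b).
Hypothesis hm : (1 < m)%N.

Local Notation inA := (inA hb).
Local Notation tpow e := (lval b ((ord_max, e) : letter m.+1)).

Definition twisting (o : Out F) := exists theta h, [/\ is_aut theta,
  sval o = out_class theta, inA h, forall g, inA g -> theta g = g
  & theta (tpow true) = tpow true * h].

(** The lower quasi-isometry inequality would bound the orbit of [c] under twists, against
    [es_orbit_unbounded]. *)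
Lemma bounded_orbit_not_qi (Y : Type) (adjY : Y -> Y -> Prop) (f : ES F -> Y) c k :
  (forall o, twisting o -> near_by adjY k (f c) (f (es_act o c))) ->
  ~ quasi_isometry (@d_ES R F) (gdist R adjY) f.
Proof.
move=> bnd [K [C [K1 C0 qi _]]].
have K0 : (0 < K)%R by exact: lt_le_trans ltr01 K1.
pose B := (K * (k%:R + C))%R.
have B0 : (0 <= B)%R by apply: mulr_ge0; [exact: ltW|apply: addr_ge0].
have [h [Ah unb]] := es_orbit_unbounded hb hm c (Num.Def.archi_bound B).
have [theta [autt fixA tE]] := twist_aut (instd1 hb _) Ah.
rewrite mul1g in tE.
pose o : Out F := exist _ (out_class theta) (ex_intro2 _ _ theta autt erefl).
have tw : twisting o by exists theta, h.
have [j le wj] : near_by (@es_adj F) (Num.Def.archi_bound B) c (es_act o c).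
  apply: (near_by_gdist (C := B)); last exact: archi_boundP.
  have [low _] := qi c (es_act o c).
  have := le_trans low (gdist_near_by R (bnd o tw)); rewrite -/(@d_ES R F c (es_act o c)).
  (* The value [+oo] contradicts the inequality, whose right side is finite; the value [-oo]
     satisfies the goal at once. *)
  case: (d_ES R c (es_act o c)) => [r| |]; last 2 first.
  - by rewrite mulry gtr0_sg ?invr_gt0 // mul1e.
  - by rewrite leNye.
  rewrite -EFinM -EFinB !lee_fin lerBlDr => H.
  by rewrite /B -ler_pdivrMl.
exact: (unb theta o autt erefl fixA tE j le).
Qed.

Lemma fixed_point_no_equivariant_qi (Y : Type) (adjY : Y -> Y -> Prop)
    (actY : Out F -> Y -> Y) (y0 : Y) :
  (forall x y, adjY x y -> adjY y x) ->
  (forall o x y, adjY x y -> actY o x = actY o y \/ adjY (actY o x) (actY o y)) ->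
  (forall o, twisting o -> actY o y0 = y0) ->
  ~ exists f, quasi_isometry (@d_ES R F) (gdist R adjY) f /\
      coarsely_equivariant (@es_act F) actY (gdist R adjY) f.
Proof.
move=> sym lip fix0 [f [qi [C' eqv]]]; have [K [C [_ C0 _ surj]]] := qi.
have [c near_c] := surj y0.
have bnd (r : R) : exists k : nat, (r < k%:R)%R.
  exists (Num.Def.archi_bound `|r|).
  exact: le_lt_trans (ler_norm r) (archi_boundP (normr_ge0 r)).
have [k kC] := bnd C; have [k' kC'] := bnd C'.
have nc := near_by_gdist near_c kC.
(* The chain runs from [f c] to the fixed vertex [y0], on to [actY o (f c)], and from there to
   [f (es_act o c)]. *)
apply: (@bounded_orbit_not_qi _ adjY f c (k + (k + k'))) qi => o tw.
apply: near_by_trans (near_by_sym sym nc) _.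
apply: (@near_by_trans _ _ _ _ _ (actY o (f c))).
  by rewrite -{1}(fix0 o tw); exact: near_by_map (lip o) nc.
by apply: near_by_sym => //; exact: near_by_gdist (eqv o c) kC'.
Qed.

End Obstruction.

(** * Fixed points in the other graphs *)

Lemma hom_onV (G H : groupType) (A : set G) (psi : G -> H) (g : G) : is_subgroup A ->
  hom_on A psi -> A g -> psi g^-1 = (psi g)^-1.
Proof.
move=> sA hA Ag; have psi1 : psi 1 = 1.
  by apply: (@mulgI _ (psi 1)); rewrite -hA ?mulg1 //; exact: sg1.
apply: (@mulgI _ (psi g)); rewrite -hA ?mulgV ?psi1 ?mulgV //; exact: sgV.
Qed.

(** * Free factors spanned by parts of the basis *)

Section StandardFactors.
Variables (F : groupType) (m : nat) (b : 'I_m.+1 -> F) (hb : is_basis b).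
Implicit Types (g h : F) (x : letter m.+1) (r : pred 'I_m.+1).

Definition stdset r : set F := [set g | instd hb r g].

Lemma stdset_eq (H : groupType) r (phi psi : F -> H) : is_hom phi ->
  hom_on (stdset r) psi -> (forall i, r i -> phi (b i) = psi (b i)) ->
  forall g, stdset r g -> phi g = psi g.
Proof.
move=> hphi hpsi E; have sr := instd_sg hb r.
have psi1 : psi 1 = 1.
  by apply: (@mulgI _ (psi 1)); rewrite -hpsi ?mulg1 //; exact: sg1 sr.
move=> g; rewrite /stdset /= /instd -[g in phi g](nfK hb) -[g in psi g](nfK hb).
elim: (nf hb g) => [|x w IH] /=; first by rewrite (hom1 hphi) psi1.
move=> /andP[rx rw]; have rl : stdset r (lval b x) by rewrite /stdset /= instd_lval.
have rW : stdset r (weval b w).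
  elim: w rw {IH} => [|y w IH] /=; first by rewrite /stdset /= instd1.
  by move=> /andP[ry /IH rw]; apply: instdM; rewrite ?instd_lval.
rewrite hphi (hpsi _ _ rl rW) IH //; congr (_ * _); case: x rx rl => i e /= ri rl.
have ri' : stdset r (b i) by rewrite /stdset /= instd_b.
by rewrite /lval /=; case: e {rl}; rewrite ?(homV _ hphi) ?(hom_onV sr hpsi ri') ?E.
Qed.

Lemma stdset_free_product r : free_product2 (stdset r) (stdset (predC r)).
Proof.
split=> [[]|H psi hpsi]; [exact: instd_sg|exact: instd_sg|].
have [phi [hphi phiE]] := basis_ext hb (fun i => psi (r i) (b i)).
exists phi; split; [split=> // -[] g Ag|move=> phi' [hphi' E']].
- apply: (stdset_eq hphi (hpsi true) _ Ag) => i ri.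
  by rewrite phiE ri.
- apply: (stdset_eq hphi (hpsi false) _ Ag) => i /= ri.
  by rewrite phiE (negbTE ri).
- apply: (basis_uniq hb) => // i; rewrite phiE (E' (r i)) //.
  by rewrite /pairfam; case ri: (r i); rewrite /stdset /= instd_b /= ?ri.
Qed.

Lemma basis_neq1 i : b i <> 1.
Proof. by move=> E; have := instd_b hb pred0 i; rewrite E instd1. Qed.

Lemma stdset_nontrivial r i : r i -> nontrivial (stdset r).
Proof. by move=> ri; exists (b i); [rewrite /stdset /= instd_b|exact: basis_neq1]. Qed.

Lemma stdset_is_ff r i j : r i -> ~~ r j -> is_ff (ff_class (stdset r)).
Proof.
move=> ri rj; exists (stdset r); split=> //; last exact: stdset_nontrivial ri.
  by exists (stdset (predC r)); exact: stdset_free_product.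
move=> E; have : stdset r (b j) by rewrite E.
by rewrite /stdset /= instd_b; apply/negP.
Qed.

End StandardFactors.

(** * Symmetry and the action on the free factor graph *)

Section FactorGraph.
Variable F : groupType.
Implicit Types (c d : FF F).

Lemma ff_adj_sym c d : ff_adj c d -> ff_adj d c.
Proof.
move=> [ne [A [A' [cA dA' H]]]]; split; first by move=> E; exact: ne.
by exists A', A; split=> //; case: H; [right|left].
Qed.

Lemma out_rep (o : Out F) : exists phi, [/\ is_aut phi, sval o = out_class phi & sval o phi].
Proof.
have [phi aphi oE] := svalP o; exists phi; split=> //.
by rewrite oE; exists 1; apply/funext => x; rewrite conjg1.
Qed.

Lemma ff_act_adj (o : Out F) c d : ff_adj c d ->
  ff_act o c = ff_act o d \/ ff_adj (ff_act o c) (ff_act o d).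
Proof.
move=> [_ [A [A' [cA dA' H]]]]; have [phi [_ _ oP]] := out_rep o.
have [->|ne] := pselect (ff_act o c = ff_act o d); [by left|right].
split=> //; exists (phi @` A), (phi @` A'); split; first by exists phi, A.
  by exists phi, A'.
by case: H => H; [left|right]; exact: image_subset.
Qed.

Lemma ff_subset_near c d (A A' : set F) : sval c = ff_class A -> sval d = ff_class A' ->
  A `<=` A' -> near_by (@ff_adj F) 1 c d.
Proof.
move=> cE dE H; have [->|ne] := pselect (c = d); first exact: near_by_refl.
apply: near_by_adj; split=> //; exists A, A'; split; last by left.
  by rewrite cE; exists 1 => //; rewrite conjs1.
by rewrite dE; exists 1 => //; rewrite conjs1.
Qed.

End FactorGraph.

(** * Symmetry and the action on the free splitting graph *)

Section SplittingGraph.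
Variable F : groupType.
Implicit Types (c d : FS F) (X Y Z : gog F).

Lemma fs_adj_sym c d : fs_adj c d -> fs_adj d c.
Proof.
move=> [ne [X [Y [Z [cX dY fZ ZX ZY]]]]]; split; first by move=> E; exact: ne.
by exists Y, X, Z.
Qed.

Lemma generated_sg (S : set F) : is_subgroup (generated S).
Proof.
split=> [A sA _|x y Hx Hy A sA SA]; first exact: sg1.
by apply: sA.2; [exact: Hx|exact: Hy].
Qed.

Lemma image_generated (phi : F -> F) (S : set F) : is_hom phi ->
  phi @` generated S = generated (phi @` S).
Proof.
move=> hphi; apply/seteqP; split=> [_ [x Hx <-] A sA SA|x].
  apply: (Hx [set y | A (phi y)]) => [|y Sy]; last by apply: SA; exists y.
  split=> [|y z Ay Az]; first by rewrite /= (hom1 hphi); exact: sg1.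
  by rewrite /= hphi homV //; exact: sA.2.
apply; first exact/is_subgroup_image/generated_sg.
by move=> _ [y Sy <-]; exists y => // A _; apply.
Qed.

Lemma joins_image (phi : F -> F) X (v w : 'I_(gnV X)) (x : F) (e : 'I_(gnE X)) :
  is_hom phi -> joins v w x e ->
  @joins F (gog_image phi X) v w (phi x) e.
Proof.
move=> hphi; case=> -[es et [a [a' [Ga Ga' E]]]]; [left|right]; split=> //;
  exists (phi a), (phi a'); split; try by [exists a|exists a'].
- by rewrite /= E !hphi.
- by rewrite /= -homV // E !hphi.
Qed.

Lemma collapses_image (phi : F -> F) X Y : is_hom phi -> collapses X Y ->
  collapses (gog_image phi X) (gog_image phi Y).
Proof.
move=> hphi [f [j [h [ji fP GE JE]]]].
exists f, j, (phi \o h); split=> //.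
- move=> w; rewrite /= GE image_generated //; congr generated.
  rewrite image_setU; congr (_ `|` _).
    rewrite image_bigcup; apply: eq_bigcupr => v _.
    by rewrite aut_image_conjs.
  rewrite image_comp; apply: eq_imagel => e _ /=.
  by rewrite !hphi homV.
- move=> e; have := joins_image hphi (JE e).
  by rewrite !hphi homV.
Qed.

Lemma fs_act_rep (o : Out F) phi c X : sval o phi -> is_aut phi -> sval c X ->
  sval (fs_act o c) (gog_image phi X).
Proof.
move=> oP aphi cX; exists phi, X; split=> //.
have [X0 fX0 cE] := svalP c; have [fX _] : fs_class X0 X by rewrite -cE.
have fI := free_splitting_image aphi fX.
by split=> //; apply: gog_iso_refl; exact: free_splitting_groups fI.
Qed.

Lemma fs_act_adj (o : Out F) c d : fs_adj c d ->
  fs_act o c = fs_act o d \/ fs_adj (fs_act o c) (fs_act o d).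
Proof.
move=> [_ [X [Y [Z [cX dY fZ ZX ZY]]]]]; have [phi [aphi _ oP]] := out_rep o.
have [->|ne] := pselect (fs_act o c = fs_act o d); [by left|right].
split=> //; exists (gog_image phi X), (gog_image phi Y), (gog_image phi Z); split.
- exact: fs_act_rep.
- exact: fs_act_rep.
- exact: free_splitting_image.
- by apply: collapses_image => //; case: aphi.
- by apply: collapses_image => //; case: aphi.
Qed.

(** Strict equivariance reduces the claim about [imath] to the one about coarsely equivariant
    maps. *)
Lemma imath_act (o : Out F) (c : ES F) : imath (es_act o c) = fs_act o (imath c).
Proof.
have [phi [aphi oE _]] := out_rep o; have [A [B [fAB nA nB cE]]] := svalP c.
apply: sval_inj; rewrite /= cE (es_act_class _ _ aphi oE).
rewrite imath_class; [|exact: free_product2_image|exact: nontrivial_image|exact: nontrivial_image].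
rewrite imath_class // (fs_act_class aphi oE); last exact: free_splitting_amalgam.
congr fs_class; rewrite /amalgam /gog_image /=; congr Gog.
  by apply/funext => v; case: ifP.
by apply/funext => e; rewrite hom1 //; case: aphi.
Qed.

Definition hnn (A : set F) (t : F) : gog F :=
  @Gog F 1 1 (fun=> ord0) (fun=> ord0) pred0 (fun=> A) (fun=> t).

End SplittingGraph.

(** * Vertices fixed by the twists *)

Section FixedPoints.
Variables (F : groupType) (m : nat) (b : 'I_m.+1 -> F) (hb : is_basis b).
Hypothesis hm : (1 < m)%N.

Local Notation inA := (inA hb).
Local Notation tpow e := (lval b ((ord_max, e) : letter m.+1)).
Local Notation stdA := (stdset hb (predC1 ord_max)).
Local Notation stdT := (stdset hb (predC (predC1 ord_max))).

Lemma hnn_free_splitting : free_splitting 1 (hnn stdA (b ord_max)).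
Proof.
split=> [||v]; last 2 first; first by [].
  (* The loop counts at both of its ends, so the vertex has valence two and minimality imposes no
     condition. *)
  have one (p : pred 'I_1) : (forall e, p e) -> #|p| = 1%N.
    by move=> pT; rewrite (eq_card (B := predT)) ?card_ord // => e; rewrite !inE; exact: pT.
  by rewrite /valence !one // => e; rewrite /= (ord1 v).
split=> //= [v||H psi tau hpsi _]; first exact: instd_sg.
  split=> [v w|]; last by rewrite /= card0.
  by rewrite (ord1 v) (ord1 w) connect0.
have [phi [hphi phiE]] :=
  basis_ext hb (fun i => if i == ord_max then tau ord0 else psi ord0 (b i)).
exists phi; split; first split=> //.
- move=> v x Ax; rewrite (ord1 v); apply: (stdset_eq hphi (hpsi ord0) _ Ax) => i /= ri.
  by rewrite phiE (negbTE ri).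
- by move=> e; rewrite phiE eqxx (ord1 e).
move=> phi' [hphi' E' T']; apply: (basis_uniq hb) => // i; rewrite phiE.
case: eqP => [->|/eqP ne]; first by rewrite (T' ord0).
by rewrite (E' ord0) // /stdset /= instd_b.
Qed.

Lemma twist_fix_stdA (theta : F -> F) : (forall g, inA g -> theta g = g) ->
  theta @` stdA = stdA.
Proof.
move=> fixA; apply/seteqP; split=> [_ [g Ag <-]|g Ag]; first by rewrite fixA.
by exists g => //; rewrite fixA.
Qed.

Definition fs_point : FS F :=
  exist _ (fs_class (hnn stdA (b ord_max))) (ex_intro2 _ _ _ hnn_free_splitting erefl).

(** The image has stable letter [t * h], which lies in the same double coset of [A] as [t], so the
    Bass-Serre trees are isomorphic. *)
Lemma fs_point_fixed o : twisting hb o -> fs_act o fs_point = fs_point.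
Proof.
move=> [theta [h [autt oE Ah fixA tE]]]; apply: sval_inj.
rewrite /= (fs_act_class autt oE hnn_free_splitting); apply/esym.
have fI := free_splitting_image autt hnn_free_splitting.
apply: fs_class_eq; first exact: free_splitting_groups hnn_free_splitting.
  exact: free_splitting_groups fI.
exists id, id, (fun=> 1); split; try by exists id.
  by move=> v; rewrite /= conjs1 twist_fix_stdA.
move=> e; left; split=> //; exists 1, h; split=> /=.
- by exists 1; [exact: instd1|apply: fixA; exact: instd1].
- by exists h; [exact: Ah|exact: fixA].
- by rewrite invg1 !mul1g mulg1.
Qed.

Let ord0_neq_max : (ord0 : 'I_m.+1) != ord_max.
Proof. by rewrite -val_eqE /=; lia. Qed.

Lemma stdA_is_ff : is_ff (ff_class stdA).
Proof. by apply: (stdset_is_ff hb (i := ord0) (j := ord_max)) => //=; rewrite eqxx. Qed.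

Definition ff_point : FF F := exist _ _ stdA_is_ff.

Lemma ff_point_fixed o : twisting hb o -> ff_act o ff_point = ff_point.
Proof.
move=> [theta [h [autt oE Ah fixA tE]]]; apply: sval_inj.
by rewrite /= (ff_act_class _ autt oE) twist_fix_stdA.
Qed.

Lemma stdAT_is_es : is_es (es_class stdA stdT).
Proof.
exists stdA, stdT; split=> //; first exact: stdset_free_product.
  exact: (stdset_nontrivial hb (i := ord0)).
by apply: (stdset_nontrivial hb (i := ord_max)); rewrite /= eqxx.
Qed.

Definition es_point : ES F := exist _ _ stdAT_is_es.

(** The path is [<t>], [<a_0, t>], [<a_0>], [A]; the second factor is proper because the rank is at
    least three. *)
Lemma ff_point_near (d : FF F) : sval d = ff_class stdT -> near_by (@ff_adj F) 3 d ff_point.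
Proof.
move=> dE; pose i1 : 'I_m.+1 := inord 1.
have i1E : val i1 = 1%N by rewrite /= inordK //; lia.
have i10 : i1 != ord0 by rewrite -val_eqE i1E.
have i1m : i1 != ord_max by rewrite -val_eqE i1E /=; lia.
have f0 := stdset_is_ff hb (r := pred1 ord0) (eqxx ord0) (i10 : ~~ pred1 ord0 i1).
have f0m := stdset_is_ff hb (r := pred2 ord0 ord_max) (i := ord0) (j := i1).
have {}f0m : is_ff (ff_class (stdset hb (pred2 ord0 ord_max))).
  by apply: f0m; rewrite /= ?eqxx // negb_or i10.
have sub (r r' : pred 'I_m.+1) : (forall i, r i -> r' i) -> stdset hb r `<=` stdset hb r'.
  by move=> rr g; apply: sub_all => x; apply: rr.
pose d1 : FF F := exist _ _ f0m; pose d2 : FF F := exist _ _ f0.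
have n1 : near_by (@ff_adj F) 1 d d1.
  apply: (ff_subset_near (d := d1) dE erefl); apply: sub => i /=; rewrite negbK => ->.
  by rewrite orbT.
have n2 : near_by (@ff_adj F) 1 d2 d1.
  by apply: (ff_subset_near (c := d2) (d := d1) erefl erefl); apply: sub => i /= ->.
have n3 : near_by (@ff_adj F) 1 d2 ff_point.
  by apply: (ff_subset_near (c := d2) (d := ff_point) erefl erefl); apply: sub => i /= /eqP ->.
exact: (near_by_trans (near_by_trans n1 (near_by_sym (@ff_adj_sym F) n2)) n3).
Qed.

(** Whichever factor [Sigma] picks, it is [A], [<t>] or the image of one of them under the twist.
    All are within [3] of the fixed vertex, and [6] is twice that. *)
Lemma Sigma_orbit_near (Sigma : ES F -> FF F) o : factor_choice Sigma -> twisting hb o ->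
  near_by (@ff_adj F) 6 (Sigma es_point) (Sigma (es_act o es_point)).
Proof.
move=> choice tw; have [theta [h [autt oE Ah fixA tE]]] := tw.
have classE (A : set F) p : ff_class (conjs p A) = ff_class A.
  apply/seteqP; split=> _ [q _ <-]; first by exists (p * q) => //; rewrite conjsM.
  by exists (p^-1 * q) => //; rewrite conjsM mulVKg.
have fT : is_ff (ff_class stdT).
  by apply: (stdset_is_ff hb (i := ord_max) (j := ord0)); rewrite /= ?negbK ?eqxx.
pose dT : FF F := exist _ _ fT.
have near0 : near_by (@ff_adj F) 3 (Sigma es_point) ff_point.
  have [A [B [[p E] SE]]] := choice es_point.
  have [[AE _]|[AE _]] := set2_inj E; move: SE; rewrite AE classE => SE; last exact: ff_point_near.
  have -> : Sigma es_point = ff_point by exact: sval_inj.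
  exact: near_by_refl.
have near1 : near_by (@ff_adj F) 3 (Sigma (es_act o es_point)) ff_point.
  have [A [B []]] := choice (es_act o es_point); rewrite /= (es_act_class _ _ autt oE).
  move=> [p E] SE.
  have [[AE _]|[AE _]] := set2_inj E; move: SE; rewrite AE classE => SE.
    have -> : Sigma (es_act o es_point) = ff_point; last exact: near_by_refl.
    by apply: sval_inj; rewrite SE twist_fix_stdA.
  have -> : Sigma (es_act o es_point) = ff_act o dT.
    by apply: sval_inj; rewrite SE /= (ff_act_class _ autt oE).
  rewrite -(ff_point_fixed tw); exact: (near_by_map (@ff_act_adj F o) (ff_point_near (d := dT) erefl)).
exact: (near_by_trans (j := 3) (k := 3) near0 (near_by_sym (@ff_adj_sym F) near1)).
Qed.

End FixedPoints.

Theorem corollary5p8 (R : realType) (n : nat) (F : groupType)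
    (hn : (2 < n)%N) (hF : free_of_rank n F) :
  [/\ forall Sigma : ES F -> FF F, factor_choice Sigma ->
        ~ quasi_isometry (@d_ES R F) (@d_FF R F) Sigma,
      ~ quasi_isometry (@d_ES R F) (@d_FS R F) (@imath F),
      ~ (exists f : ES F -> FF F,
           quasi_isometry (@d_ES R F) (@d_FF R F) f /\
           coarsely_equivariant (@es_act F) (@ff_act F) (@d_FF R F) f)
    & ~ (exists f : ES F -> FS F,
           quasi_isometry (@d_ES R F) (@d_FS R F) f /\
           coarsely_equivariant (@es_act F) (@fs_act F) (@d_FS R F) f)].
Proof.
case: n hn hF => // m hm [b hb].
have noFS := fixed_point_no_equivariant_qi (R := R) hm (@fs_adj_sym F) (@fs_act_adj F)
  (@fs_point_fixed F m b hb).
split.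
- move=> Sigma choice; apply: (@bounded_orbit_not_qi R F m b hb hm _ _ Sigma (es_point hb hm) 6) => o.
  exact: Sigma_orbit_near.
- move=> qi; apply: noFS; exists (@imath F); split=> //; exists 0%R => o c.
  by rewrite imath_act; apply: (gdist_near_by R (k := 0)); exact: near_by_refl.
- exact: (fixed_point_no_equivariant_qi hm (@ff_adj_sym F) (@ff_act_adj F)
    (@ff_point_fixed F m b hb hm)).
- exact: noFS.
Qed.
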